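(* Let $n\ge1$, $\mu>1$, $C>0$. Let $K\subset\mathbb{H}_n$ be a compact connected $2$-vertical curve with $\operatorname{diam}(K)>0$, let $\zeta\colon[0,1]\to K$ be a monotone increasing parameterization of $K$, and let $\gamma=\pi\circ\zeta$. Let $(\mathcal{T},\{I_v\}_{v\in\mathcal{T}})$ be a $\mu$-dyadic patchwork for $K$ and let $\Lambda\colon\mathcal{T}\to\mathbb{R}^{2n}$ be a set of $C$-approximating points for $\mathcal{T}$. Let $g_i=g_{\Lambda,i}$ and $\sigma(\Lambda)$ be as defined in the context. If $\sigma(\Lambda)<\infty$, then $S(\hat\gamma)$ exists and $S(\hat\gamma)=\lim_{i\to\infty}S(\hat g_i)$. Furthermore, $$|S(\hat\gamma)|\lesssim_{\mu,C}\max\left\{\sigma(\Lambda),\ \sigma(\Lambda)\log\frac{(\operatorname{diam}K)^2}{\sigma(\Lambda)}\right\}$$ (the right-hand side being read as $0$ if $\sigma(\Lambda)=0$). If, in addition, $g_i(0)=g_i(1)$ for all $i$, then $|S(\hat\gamma)|\lesssim_{\mu,C}\sigma(\Lambda)$.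
   Context: Heisenberg group: $\mathbb{H}_n=\mathbb{R}^{2n+1}$ with points $(x_1,y_1,\dots,x_n,y_n,z)$, $\pi\colon\mathbb{H}_n\to\mathbb{R}^{2n}$ the projection forgetting $z$, $z(\cdot)$ the last coordinate, $\omega(u,\bar u)=\sum_{i}(x_i\bar y_i-\bar x_iy_i)$, $Z=(0,\dots,0,1)$, product $ab=a+b+\frac12\omega(\pi(a),\pi(b))Z$. The metric is the Korányi metric $d(p,q)=\|p^{-1}q\|$, $\|q\|=\sqrt[4]{|\pi(q)|^4+16z(q)^2}$; $\operatorname{diam}$ of subsets of $\mathbb{H}_n$ is with respect to $d$. Vertical curves: for $\lambda>0$, $\operatorname{VCone}_\lambda=\{q:|z(q)|\ge\lambda|\pi(q)|^2\}$. A set $E\subset\mathbb{H}_n$ is a $\lambda$-vertical curve if $E\subset p\operatorname{VCone}_\lambda$ for all $p\in E$. A compact connected $\lambda$-vertical curve with positive diameter is homeomorphic to a closed interval; a parameterization $\zeta$ (a homeomorphism from $[0,1]$) is monotone increasing if $z(\zeta(s)^{-1}\zeta(t))>0$ for all $s<t$. Trees: a rooted tree $\mathcal{T}$ is a set of vertices with root $v_0$ and a parent map $\mathcal{P}\colon\mathcal{T}\setminus\{v_0\}\to\mathcal{T}$ such that every $v\neq v_0$ satisfies $\mathcal{P}^i(v)=v_0$ for some $i$. The children of $v$ are $\mathcal{C}(v)=\mathcal{P}^{-1}(v)$, $\mathcal{T}^i$ is the set of $i$th-generation descendants of $v_0$ ($\mathcal{T}^0=\{v_0\}$), and $\operatorname{gen}(v)=i$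 for $v\in\mathcal{T}^i$. A $\mu$-dyadic patchwork for $K$ is a pair $(\mathcal{T},\{I_v\}_{v\in\mathcal{T}})$ such that: (1) $\mathcal{T}$ is a rooted tree of degree at most $\mu$ (each vertex has at most $\mu$ children); (2) each $I_v$ is a closed subinterval of $K$ with distinct endpoints, and $I_{v_0}=K$; (3) for each $v$, $\{I_w\}_{w\in\mathcal{C}(v)}$ partitions $I_v$ (they cover $I_v$ and overlap only at endpoints); (4) for all $v\in\mathcal{T}^i$, $\operatorname{diam}I_v\in[\mu^{-1}2^{-i}\operatorname{diam}K,\ \mu2^{-i}\operatorname{diam}K]$. Let $J_v=\zeta^{-1}(I_v)\subset[0,1]$, a closed interval, with midpoint $m_v$. A map $\Lambda\colon\mathcal{T}\to\mathbb{R}^{2n}$ is a set of $C$-approximating points for $\mathcal{T}$ if $|\Lambda(v)-\gamma(m_v)|\le C2^{-\operatorname{gen}(v)}\operatorname{diam}(K)$ for all $v\in\mathcal{T}$. For $i\ge0$, label the elements of $\mathcal{T}^i$ as $w_1,\dots,w_k$ so that $J_{w_1},J_{w_2},\dots$ are in increasing order; let $s_j=m_{w_j}$ for $1\le j\le k$, $s_0=0$, $s_{k+1}=1$. Then $g_i=g_{\Lambda,i}\colon[0,1]\to\mathbb{R}^{2n}$ is the piecewise-linear curve with $g_i(s_0)=\Lambda(w_1)$, $g_i(s_j)=\Lambda(w_j)$ for $1\le j\le k$, $g_i(s_{k+1})=\Lambda(w_k)$, affine on each $[s_{j-1},s_j]$. For $v\in\mathcal{T}^i$ let $\delta_\Lambda(v)=\operatorname{diam}(g_i(J_v)\cup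 g_{i+1}(J_v))$ and let $\sigma(\Lambda)=\sum_{v\in\mathcal{T}}\delta_\Lambda(v)^2$. Symplectic area: for a continuous curve $\gamma\colon[a,b]\to\mathbb{R}^{2n}$ and a partition $P=\{t_1<\dots<t_k\}$ of $[a,b]$ with $t_1=a,t_k=b$, let $\hat S(\gamma_P)=\frac12\sum_{i=1}^{k-1}\omega(\gamma(t_i),\gamma(t_{i+1}))$. $S(\gamma)$ exists and equals $L$ if for every $\epsilon>0$ there is $\delta>0$ such that $\operatorname{mesh}(P)=\max_i(t_{i+1}-t_i)<\delta$ implies $|L-\hat S(\gamma_P)|<\epsilon$. For any curve $g$, $\hat g$ is the closed curve obtained by connecting the endpoints of $g$ by a line segment. $X\lesssim_{\mu,C}Y$ means $X\le cY$ with $c$ depending only on $\mu$, $C$ (and the fixed $n$). *)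

(* Defs.v *)
From HB Require Import structures.
From mathcomp Require Import all_boot all_order all_algebra finmap ring.
From mathcomp Require Import all_classical all_reals all_analysis.

Set Implicit Arguments.
Unset Strict Implicit.
Unset Printing Implicit Defensive.

Import Order.TTheory GRing.Theory Num.Theory.
Import numFieldNormedType.Exports.

Local Open Scope classical_set_scope.
Local Open Scope ring_scope.

(* The index [mxvec_index i j] of ['I_(n * 2)] has value 2 i + j, so the
   coordinates of a vector of [plane R n] are (x_1, y_1, ..., x_n, y_n). *)
Notation plane R n := 'rV[R]_(n * 2).

(* The topology is that of R^(2n+1), which is also the one induced by the
   Koranyi metric [hdist] below. *)
Notation heisenberg R n := 'rV[R]_(n * 2 + 1).

Section Heisenberg.
Context {R : realType} {n : nat}.
Implicit Types (u v : plane R n) (p q : heisenberg R n).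

Definition xcoord u (i : 'I_n) : R := u 0 (mxvec_index i (0 : 'I_2)).
Definition ycoord u (i : 'I_n) : R := u 0 (mxvec_index i (1 : 'I_2)).

Definition omega u v : R :=
  \sum_i (xcoord u i * ycoord v i - xcoord v i * ycoord u i).

(* The norm [`|u|] of the library on row vectors is the sup norm. *)
Definition enorm u : R := Num.sqrt (\sum_j u 0 j ^+ 2).
Definition edist u v : R := enorm (u - v).

Definition hproj p : plane R n := lsubmx p.
Definition hz p : R := rsubmx p 0 0.
Definition hZ : heisenberg R n := row_mx 0 1%:M.

Definition hmul p q : heisenberg R n :=
  p + q + (2^-1 * omega (hproj p) (hproj q)) *: hZ.
Definition hinv p : heisenberg R n := - p.

Definition hnorm p : R := (enorm (hproj p) ^+ 4 + 16 * hz p ^+ 2) `^ (4^-1).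
Definition hdist p q : R := hnorm (hmul (hinv p) q).

Definition vcone (lambda : R) : set (heisenberg R n) :=
  [set q | lambda * enorm (hproj q) ^+ 2 <= `|hz q|].

Definition vertical_curve (lambda : R) (E : set (heisenberg R n)) : Prop :=
  forall p, E p -> E `<=` hmul p @` vcone lambda.

Lemma omegaDl u v w : omega (u + v) w = omega u w + omega v w.
Proof.
rewrite /omega -big_split; apply: eq_bigr => i _ /=.
by rewrite /xcoord /ycoord !mxE; ring.
Qed.

Lemma omegaDr u v w : omega u (v + w) = omega u v + omega u w.
Proof.
rewrite /omega -big_split; apply: eq_bigr => i _ /=.
by rewrite /xcoord /ycoord !mxE; ring.
Qed.

Lemma omegaNl u v : omega (- u) v = - omega u v.
Proof.
rewrite /omega -sumrN; apply: eq_bigr => i _.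
by rewrite /xcoord /ycoord !mxE; ring.
Qed.

Lemma omega0l u : omega 0 u = 0.
Proof.
by apply/big1 => i _; rewrite /xcoord /ycoord !mxE mul0r mulr0 subrr.
Qed.

Lemma omegaxx u : omega u u = 0.
Proof. by apply/big1 => i _; rewrite subrr. Qed.

Lemma hproj_hmul p q : hproj (hmul p q) = hproj p + hproj q.
Proof.
by rewrite /hproj /hmul /hZ !linearD linearZ /= row_mxKl scaler0 addr0.
Qed.

Lemma hmulA p q r : hmul p (hmul q r) = hmul (hmul p q) r.
Proof.
rewrite {1 3}/hmul !hproj_hmul omegaDl omegaDr /hmul !mulrDr !scalerDl.
by rewrite !addrA [LHS](ACl (1*2*5*3*6*4)).
Qed.

Lemma hmul0p p : hmul 0 p = p.
Proof. by rewrite /hmul /hproj linear0 omega0l mulr0 scale0r add0r addr0. Qed.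

Lemma hmulVp p : hmul (hinv p) p = 0.
Proof.
rewrite /hmul /hinv /hproj linearN /= omegaNl omegaxx.
by rewrite oppr0 mulr0 scale0r addr0 addNr.
Qed.

End Heisenberg.

(* [sup] is the actual supremum on bounded nonempty sets; [diam] is only used
   on compact sets and on images of piecewise linear curves. *)
Definition diam {R : realType} {T : Type} (d : T -> T -> R) (A : set T) : R :=
  sup [set r | exists p q, [/\ A p, A q & r = d p q]].

Definition homeomorphism_on {S T : topologicalType} (A : set S) (B : set T)
    (f : S -> T) : Prop :=
  [/\ {within A, continuous f}, set_bij A B f &
      exists g : T -> S, {within B, continuous g} /\ {in A, cancel f g}].

Definition increasing_parameterization {R : realType} {n : nat}
    (K : set (heisenberg R n)) (zeta : R -> heisenberg R n) : Prop :=
  homeomorphism_on (`[0, 1] : set R) K zeta /\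
  (forall s t : R, s \in `[0, 1] -> t \in `[0, 1] -> s < t ->
     0 < hz (hmul (hinv (zeta s)) (zeta t))).

(* The parent map is only meaningful away from the root: its value at the root
   is unconstrained and never used. *)
Record rooted_tree (T : choiceType) := RootedTree {
  tree_root : T;
  parent : T -> T;
  parent_root : forall v, v != tree_root -> exists i, iter i parent v = tree_root }.

Section Tree.
Context {T : choiceType} (t : rooted_tree T).

Definition children (v : T) : set T :=
  [set w | w != tree_root t /\ parent t w = v].

Fixpoint generation (i : nat) : set T :=
  if i is j.+1 then \bigcup_(v in generation j) children v
  else [set tree_root t].

Lemma exists_depth (v : T) : exists i, iter i (parent t) v == tree_root t.
Proof.
have [->|/parent_root[i <-]] := eqVneq v (tree_root t); first by exists 0%N.
by exists i; apply/eqP.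
Qed.

Definition gen (v : T) : nat := ex_minn (exists_depth v).

Lemma generationP i v : generation i v <-> gen v = i.
Proof.
rewrite /gen; case: ex_minnP => m /eqP mv minm; split.
- elim: i v m mv minm => [|i IH] v m mv minm /=.
    by move=> vroot; apply/eqP; rewrite -leqn0; apply: minm; apply/eqP.
  move=> [w Tw [vroot pv]]; case: m mv minm => [|m] mv minm.
    by rewrite /= in mv; rewrite mv eqxx in vroot.
  congr _.+1; apply: (IH w) => //; first by rewrite -pv -iterSr.
  by move=> k; rewrite -pv -iterSr => /minm.
- move=> <-{i}; elim: m v mv minm => [//|m IH] v mv minm /=.
  exists (parent t v).
    apply: IH; first by rewrite -iterSr.
    by move=> k; rewrite -iterSr => /minm.
  by split => //; apply/eqP => v0; have := minm 0%N; rewrite /= v0 eqxx => /(_ isT).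
Qed.

End Tree.

Section Patchwork.
Context {R : realType} {n : nat} (zeta : R -> heisenberg R n).

Definition param_itv (A : set (heisenberg R n)) : set R :=
  `[0, 1] `&` zeta @^-1` A.

Definition param_left (A : set (heisenberg R n)) : R := inf (param_itv A).
Definition param_right (A : set (heisenberg R n)) : R := sup (param_itv A).
Definition param_mid (A : set (heisenberg R n)) : R :=
  (param_left A + param_right A) / 2.

Definition arc_endpoints (A : set (heisenberg R n)) : set (heisenberg R n) :=
  [set zeta (param_left A); zeta (param_right A)].

(* Closed subintervals do not depend on the parameterization [zeta]. *)
Definition is_subarc (A : set (heisenberg R n)) : Prop :=
  exists a b : R, [/\ 0 <= a, a < b, b <= 1 & A = zeta @` `[a, b]].

Context {T : choiceType}.

Definition is_patchwork (mu : R) (K : set (heisenberg R n))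
    (t : rooted_tree T) (I : T -> set (heisenberg R n)) : Prop :=
  [/\ forall v, finite_set (children t v) /\
                (#|` fset_set (children t v)|)%:R <= mu,
      (forall v, is_subarc (I v)) /\ I (tree_root t) = K,
      forall v, \bigcup_(w in children t v) I w = I v /\
        (forall w w', children t v w -> children t v w' -> w != w' ->
           I w `&` I w' `<=` arc_endpoints (I w) `&` arc_endpoints (I w'))
    & forall i v, generation t i v ->
        mu^-1 * 2 ^- i * diam hdist K <= diam hdist (I v)
          <= mu * 2 ^- i * diam hdist K].

Definition approximating_points (C : R) (K : set (heisenberg R n))
    (t : rooted_tree T) (I : T -> set (heisenberg R n))
    (Lambda : T -> plane R n) : Prop :=
  forall v, edist (Lambda v) (hproj (zeta (param_mid (I v))))
            <= C * 2 ^- gen t v * diam hdist K.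

(* Piecewise linear interpolation of the nodes (s, p) :: l, the time
   coordinates being increasing; constant before s and after the last node. *)
Fixpoint pl_interp (s : R) (p : plane R n) (l : seq (R * plane R n)) (x : R) :
    plane R n :=
  if l is (s', p') :: l' then
    if x <= s then p
    else if x <= s' then p + ((x - s) / (s' - s)) *: (p' - p)
    else pl_interp s' p' l' x
  else p.

(* The vertices of generation i, listed in increasing order of the intervals
   J_v = param_itv (I v). *)
Definition ordered_generation (t : rooted_tree T)
    (I : T -> set (heisenberg R n)) (i : nat) : seq T :=
  sort (fun v w => param_left (I v) <= param_left (I w))
       (fset_set (generation t i)).

Definition gcurve (t : rooted_tree T) (I : T -> set (heisenberg R n))
    (Lambda : T -> plane R n) (i : nat) : R -> plane R n :=
  let ws := ordered_generation t I i in
  let w1 := head (tree_root t) ws in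
  let wk := last (tree_root t) ws in
  pl_interp 0 (Lambda w1)
    (rcons [seq (param_mid (I w), Lambda w) | w <- ws] (1, Lambda wk)).

Definition delta (t : rooted_tree T) (I : T -> set (heisenberg R n))
    (Lambda : T -> plane R n) (v : T) : R :=
  let i := gen t v in
  diam edist (gcurve t I Lambda i @` param_itv (I v) `|`
              gcurve t I Lambda i.+1 @` param_itv (I v)).

Definition sigma (t : rooted_tree T) (I : T -> set (heisenberg R n))
    (Lambda : T -> plane R n) : \bar R :=
  \esum_(v in [set: T]) (delta t I Lambda v ^+ 2)%:E.

End Patchwork.

Section SymplecticArea.
Context {R : realType} {n : nat}.
Implicit Types (a b L : R) (g : R -> plane R n).

(* As in the library's [itv_partition a b s], the partition is a :: s. *)
Definition area_sum g a (s : seq R) : R :=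
  2^-1 * \sum_(i < size s) omega (g (nth a (a :: s) i)) (g (nth a s i)).

Definition mesh_lt a (s : seq R) (d : R) : Prop :=
  forall i, (i < size s)%N -> nth a s i - nth a (a :: s) i < d.

Definition is_symplectic_area a b g L : Prop :=
  forall e : R, 0 < e -> exists2 d : R, 0 < d &
    forall s, itv_partition a b s -> mesh_lt a s d -> `|L - area_sum g a s| < e.

Definition has_symplectic_area a b g : Prop :=
  exists L, is_symplectic_area a b g L.

(* Only meaningful when [has_symplectic_area a b g]. *)
Definition symplectic_area a b g : R := get (is_symplectic_area a b g).

(* For g defined on [0, 1], the closed curve on [0, 2] that follows g and then
   the segment from g 1 to g 0. *)
Definition close_curve g : R -> plane R n := fun x =>
  if x <= 1 then g x else g 1 + (x - 1) *: (g 0 - g 1).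

End SymplecticArea.

(* Main.v *)
Require Import Defs.
From mathcomp Require Import all_boot all_order all_algebra finmap.
From mathcomp Require Import all_classical all_reals all_analysis.
From mathcomp Require Import ring lra.

(** The area of the projection gamma of the curve is computed by comparing the
    polygons [g i] of successive generations, and the area of a fine polygon
    inscribed in gamma is compared with that of [g i] by the same estimate on
    short intervals.

    For a curve g with area primitive A, the excess A t - A s - chord g s t is
    the area between g on [[s, t]] and its chord. When [g i] is replaced by
    [g i.+1], each vertex v of generation i contributes O(delta(v)^2), because on
    its interval both curves consist of boundedly many segments in a set of
    diameter delta(v) ([norm_flux_le]). What remains is the area of the
    quadrilateral spanned by the old and the new endpoints over s and t
    ([excess_succ]). It vanishes for closed curves, which gives the bound by
    sigma. In general the sum over i of these quadrilaterals is at most the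
    square of the sum of the displacements of the endpoints. The displacement at
    step i is bounded both by values of delta, whose squares have total at most
    sigma, and by a multiple of 2^-i diam K: the first bound is used for N steps
    and the second one afterwards ([sqr_sum_le_split]), which gives a bound
    O(N sigma + 4^-N (diam K)^2) for every N ([norm_excess_le]), and the best N
    produces the logarithm ([le_sigma_log]). In particular the areas of the
    closed polygons converge.

    For a partition r of [[0, 1]] the excess over each interval [[s, t]] of r is
    estimated in the same way, but from the first generation whose intervals
    are not much longer than [[s, t]] ([exists_start_generation]). A vertex
    contributes to boundedly many intervals of r ([partition_sum_charge]). Hence
    the total excess is O(N tau + 4^-N H), where tau is the part of sigma that
    comes from late generations and H is the sum over r of the squared distances
    between consecutive points of the curve ([norm_area_sub_le]). This is where verticality enters: the
    squared distance between two points of the curve is comparable to their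
    vertical displacement ([sqr_hdist_le]), and the sum of the displacements over
    r is z(1) - z(0) minus the sum of chords of gamma ([partition_sum_height]).
    So H is controlled by the quantity under study, the estimate with a fixed
    large N bounds H independently of r, and then N large and tau small make the
    error arbitrarily small ([is_symplectic_area_limit]). *)

Set Implicit Arguments.
Unset Strict Implicit.
Unset Printing Implicit Defensive.

Import Order.TTheory GRing.Theory Num.Theory.
Import numFieldNormedType.Exports.

Local Open Scope classical_set_scope.
Local Open Scope ring_scope.

Local Notation edist := Defs.edist.

(** * Euclidean norm and symplectic form *)

Lemma cauchy_schwarz_sum {R : realFieldType} (I : finType) (a b : I -> R) :
  (\sum_i a i * b i) ^+ 2 <= (\sum_i a i ^+ 2) * (\sum_i b i ^+ 2).
Proof.
set A := \sum_i a i ^+ 2; set B := \sum_i b i ^+ 2; set P := \sum_i a i * b i.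
have A0 : 0 <= A by apply: sumr_ge0 => i _; exact: sqr_ge0.
have [A0'|A1] := eqVneq A 0.
  suff -> : P = 0 by rewrite A0' expr0n mul0r.
  apply: big1 => i _; suff /eqP -> : a i == 0 by rewrite mul0r.
  rewrite -sqrf_eq0; move/eqP: A0'; rewrite psumr_eq0 => [|j _]; last exact: sqr_ge0.
  by move=> /allP/(_ i); rewrite mem_index_enum; exact.
have Ap : 0 < A by rewrite lt_def A1.
rewrite -subr_ge0 -(pmulr_rge0 _ Ap).
have -> : A * (A * B - P ^+ 2) = \sum_i (A * b i - P * a i) ^+ 2.
  under eq_bigr => i _.
    rewrite (_ : _ ^+ 2 = A ^+ 2 * b i ^+ 2 - 2 * A * P * (a i * b i) +
      P ^+ 2 * a i ^+ 2); last by ring.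
    over.
  by rewrite !big_split/= sumrN -!mulr_sumr -/A -/B -/P; ring.
by apply: sumr_ge0 => i _; exact: sqr_ge0.
Qed.

Section Enorm.
Context {R : realType} {n : nat}.
Implicit Types (u v w p q : plane R n) (a : R).

Lemma enorm_ge0 u : 0 <= enorm u.
Proof. exact: sqrtr_ge0. Qed.
Hint Resolve enorm_ge0 : core.

Lemma sqr_enorm u : enorm u ^+ 2 = \sum_j u 0 j ^+ 2.
Proof. by rewrite sqr_sqrtr//; apply: sumr_ge0 => j _; exact: sqr_ge0. Qed.

Lemma enormN u : enorm (- u) = enorm u.
Proof.
by rewrite /enorm; congr Num.sqrt; apply: eq_bigr => j _; rewrite mxE sqrrN.
Qed.

Lemma enormZ a u : enorm (a *: u) = `|a| * enorm u.
Proof.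
rewrite /enorm -sqrtr_sqr -sqrtrM ?sqr_ge0//; congr Num.sqrt.
by rewrite mulr_sumr; apply: eq_bigr => j _; rewrite mxE exprMn.
Qed.

Lemma enorm0 : enorm (0 : plane R n) = 0.
Proof. by rewrite -(scale0r 0) enormZ normr0 mul0r. Qed.

Lemma ler_enormD u v : enorm (u + v) <= enorm u + enorm v.
Proof.
rewrite -(@ler_pXn2r _ 2) ?nnegrE ?addr_ge0// sqrrD !sqr_enorm.
have -> : \sum_j (u + v) 0 j ^+ 2 = \sum_j u 0 j ^+ 2 +
    (\sum_j u 0 j * v 0 j) *+ 2 + \sum_j v 0 j ^+ 2.
  by rewrite -sumrMnl -!big_split/=; apply: eq_bigr => j _; rewrite mxE sqrrD.
rewrite lerD2r lerD2l lerMn2r/=.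
rewrite (le_trans (ler_norm _))//.
rewrite -(@ler_pXn2r _ 2) ?nnegrE ?mulr_ge0//.
by rewrite real_normK ?num_real// exprMn !sqr_enorm cauchy_schwarz_sum.
Qed.

Lemma edist_ge0 u v : 0 <= edist u v.
Proof. exact: enorm_ge0. Qed.

Lemma edistC u v : edist u v = edist v u.
Proof. by rewrite /edist -enormN opprB. Qed.

Lemma edistxx u : edist u u = 0.
Proof. by rewrite /edist subrr enorm0. Qed.

Lemma edist_triangle v u w : edist u w <= edist u v + edist v w.
Proof.
by rewrite /edist (le_trans _ (ler_enormD _ _))// addrA subrK.
Qed.

Lemma sum_pairs (f : plane R n -> 'I_(n * 2) -> R) u :
  \sum_j f u j = \sum_(i < n) (f u (mxvec_index i 0) + f u (mxvec_index i 1)).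
Proof.
transitivity (\sum_(i < n) \sum_(k < 2) f u (mxvec_index i k)); last first.
  apply: eq_bigr => i _; rewrite big_ord_recl big_ord1 /=.
  by congr (f u (mxvec_index i _) + f u (mxvec_index i _)); exact: val_inj.
rewrite pair_bigA (reindex _ (curry_mxvec_bij n 2))/=.
by apply: eq_bigr => -[i k].
Qed.

(** Up to the rotation (x, y) |-> (- y, x) of each coordinate plane, the
    symplectic form is the Euclidean inner product. *)
Lemma norm_omega_le u v : `|omega u v| <= enorm u * enorm v.
Proof.
rewrite -(@ler_pXn2r _ 2) ?nnegrE ?mulr_ge0// real_normK ?num_real//.
rewrite exprMn !sqr_enorm (sum_pairs (fun u j => u 0 j ^+ 2))
  (sum_pairs (fun u j => u 0 j ^+ 2)).
pose a (k : 'I_n * bool) := if k.2 then xcoord u k.1 else ycoord u k.1.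
pose b (k : 'I_n * bool) := if k.2 then ycoord v k.1 else - xcoord v k.1.
have := cauchy_schwarz_sum a b.
have sumE (F : 'I_n * bool -> R) :
    \sum_k F k = \sum_i (F (i, true) + F (i, false)).
  under [RHS]eq_bigr => i _ do rewrite -(big_bool _ (fun k => F (i, k))).
  by rewrite pair_bigA; apply: eq_bigr => -[].
rewrite !sumE; congr (_ <= _).
  congr (_ ^+ 2); apply: eq_bigr => i _; rewrite /a /b/=; ring.
by congr (_ * _); apply: eq_bigr => i _; rewrite /a /b/= ?sqrrN// addrC.
Qed.

Lemma omegaZl a u v : omega (a *: u) v = a * omega u v.
Proof.
rewrite /omega mulr_sumr; apply: eq_bigr => i _.
by rewrite /xcoord /ycoord !mxE; ring.
Qed.

Lemma omegaC u v : omega u v = - omega v u.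
Proof.
by rewrite /omega -sumrN; apply: eq_bigr => i _; ring.
Qed.

Lemma omegaZr a u v : omega u (a *: v) = a * omega u v.
Proof. by rewrite omegaC omegaZl omegaC mulrN opprK. Qed.

Lemma omegaNr u v : omega u (- v) = - omega u v.
Proof. by rewrite omegaC omegaNl omegaC opprK. Qed.

Lemma norm_omega_sub_le p q p' q' (d d' : R) :
  edist p q <= d -> edist p' q' <= d' -> `|omega (p - q) (p' - q')| <= d * d'.
Proof.
by move=> pq pq'; rewrite (le_trans (norm_omega_le _ _))// ler_pM.
Qed.

End Enorm.
#[global] Hint Extern 0 (is_true (_ <= enorm _)) =>
  solve [apply: enorm_ge0] : core.
#[global] Hint Extern 0 (is_true (_ <= Defs.edist _ _)) =>
  solve [apply: edist_ge0] : core.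

(** * Sums over partitions and symplectic area *)

Section PartitionSums.
Context {R : realType}.
Implicit Types (f : R -> R -> R) (a b c d : R) (s : seq R).

Fixpoint partition_sum f a s : R :=
  if s is x :: s' then f a x + partition_sum f x s' else 0.

Lemma mesh_lt_cons a x s d :
  mesh_lt a (x :: s) d <-> x - a < d /\ mesh_lt x s d.
Proof.
split=> [h|[xa h] [|i]//= si].
- split; first exact: (h 0%N).
  move=> i si; have := h i.+1 si => /=.
  by rewrite (set_nth_default x)// (set_nth_default x)//= ltnW.
- by rewrite (set_nth_default x)// (set_nth_default x)//= ?h// ltnS ltnW.
Qed.

Lemma partition_sum_telescope (F : R -> R) a s :
  partition_sum (fun x y => F y - F x) a s = F (last a s) - F a.
Proof.
by elim: s a => [|x s IH] a /=; rewrite ?subrr// IH addrC subrKA.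
Qed.

Lemma partition_sumD f f' a s :
  partition_sum (fun x y => f x y + f' x y) a s =
  partition_sum f a s + partition_sum f' a s.
Proof. by elim: s a => [|x s IH] a /=; rewrite ?addr0// IH addrACA. Qed.

Lemma partition_sumZ c f a s :
  partition_sum (fun x y => c * f x y) a s = c * partition_sum f a s.
Proof. by elim: s a => [|x s IH] a /=; rewrite ?mulr0// IH mulrDr. Qed.

Lemma partition_sum_sum (J : Type) (r : seq J) (f : J -> R -> R -> R) a s :
  partition_sum (fun x y => \sum_(j <- r) f j x y) a s =
  \sum_(j <- r) partition_sum (f j) a s.
Proof.
by elim: s a => [|x s IH] a /=; [rewrite big1|rewrite IH big_split].
Qed.

Lemma ler_partition_sum f f' a b s : itv_partition a b s ->
  (forall x y, a <= x -> x < y -> y <= b -> f x y <= f' x y) ->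
  partition_sum f a s <= partition_sum f' a s.
Proof.
elim: s a => [//|x s IH] a /= abs ff'; have sb := itv_partition_cons abs.
have ax : a < x by case: abs => /= /andP[].
apply: lerD; first by apply: ff' => //; exact: itv_partition_le sb.
by apply: IH => // y z xy; apply: ff'; rewrite (le_trans (ltW ax)).
Qed.

Lemma partition_sum_mesh f f' a b d s : itv_partition a b s -> mesh_lt a s d ->
  (forall x y, a <= x -> x < y -> y <= b -> y - x < d -> f x y <= f' x y) ->
  partition_sum f a s <= partition_sum f' a s.
Proof.
elim: s a => [//|x s IH] a /= abs /mesh_lt_cons[xad md] ff'.
have sb := itv_partition_cons abs.
have ax : a < x by case: abs => /= /andP[].
apply: lerD; first by apply: ff' => //; exact: itv_partition_le sb.
by apply: IH => // y z xy; apply: ff'; rewrite (le_trans (ltW ax)).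
Qed.

Lemma partition_sum_ge0 f a b s : itv_partition a b s ->
  (forall x y, a <= x -> x < y -> y <= b -> 0 <= f x y) ->
  0 <= partition_sum f a s.
Proof.
move=> abs f0; apply: le_trans (ler_partition_sum abs f0).
by elim: s a {abs f0} => //= x s IH a; rewrite add0r.
Qed.

Lemma norm_partition_sum f a s :
  `|partition_sum f a s| <= partition_sum (fun x y => `|f x y|) a s.
Proof.
elim: s a => [|x s IH] a /=; first by rewrite normr0.
by rewrite (le_trans (ler_normD _ _))// lerD2l.
Qed.

(** A point lies in at most two of the closed intervals of a partition; the
    induction has to remember whether it is still ahead. *)
Lemma partition_sum_mem_le2 c a s : path <%R a s ->
  partition_sum (fun x y => (x <= c <= y)%R%:R) a s <= 2.
Proof.
move=> pas; apply: (@le_trans _ _ ((a <= c)%R%:R + (a < c)%R%:R)); last first.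
  by case: (a <= c); case: (a < c); rewrite /=; lra.
elim: s a pas => [|x s IH] a /=; first by rewrite addr_ge0.
move=> /andP[ax /IH]; move: (partition_sum _ _ _) => P.
by case: (ltgtP a c) => ac; case: (ltgtP x c) => xc /=; lra.
Qed.

(** Peeling off one step of length [d / 2] at a time. *)
Lemma exists_fine_partition a b d : a <= b -> 0 < d ->
  exists2 s, itv_partition a b s & mesh_lt a s d.
Proof.
move=> ab d0; have d20 : 0 < d / 2 by rewrite divr_gt0.
have [N bN] : exists N : nat, b - a < N%:R * (d / 2).
  have /archi_boundP : 0 <= (b - a) / (d / 2).
    by rewrite divr_ge0 ?subr_ge0// ltW.
  by rewrite ltr_pdivrMr// => h; exists (Num.bound ((b - a) / (d / 2))).
elim: N a ab bN => [|N IH] a ab bN; first by rewrite mul0r subr_lt0 ltNge ab in bN.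
have [abd|abd] := ltP (b - a) d.
- have [<-|aneb] := eqVneq a b.
    by exists [::] => //; split => //=.
  exists [:: b]; first by apply: itv_partition1; rewrite lt_def eq_sym aneb.
  by apply/mesh_lt_cons; split.
- have [||s [ps ls] ms] := IH (a + d / 2).
  + by lra.
  + by move: bN; rewrite -(natr1 N) mulrDl mul1r; lra.
  exists (a + d / 2 :: s); first by split => //=; rewrite ps ltrDl d20.
  by apply/mesh_lt_cons; split => //; lra.
Qed.

End PartitionSums.

Section Area.
Context {R : realType} {n : nat}.
Implicit Types (g : R -> plane R n) (a b : R) (s : seq R).

(** The signed area of the triangle with vertices 0, [g x] and [g y]. *)
Definition chord g x y : R := 2^-1 * omega (g x) (g y).

Lemma area_sumE g a s : area_sum g a s = partition_sum (chord g) a s.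
Proof.
rewrite /area_sum; elim: s a => [|x s IH] a /=; first by rewrite big_ord0 mulr0.
rewrite big_ord_recl mulrDr -IH; congr (_ + _ * _).
apply: eq_bigr => i _; rewrite /= [in RHS](set_nth_default a)//=.
  by rewrite [in RHS](set_nth_default a).
by rewrite ltnS ltnW.
Qed.

Lemma is_symplectic_area_unique a b g L L' : a <= b ->
  is_symplectic_area a b g L -> is_symplectic_area a b g L' -> L = L'.
Proof.
move=> ab gL gL'; apply/eqP; rewrite -subr_eq0 -normr_eq0.
apply: contraT; set e := `|_| => e_neq0.
have e0 : 0 < e / 2 by rewrite divr_gt0// lt_def e_neq0 normr_ge0.
have [d d0 dL] := gL _ e0; have [d' d'0 dL'] := gL' _ e0.
have [|s sab smesh] := @exists_fine_partition _ a b (Num.min d d') ab.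
  by rewrite lt_min d0.
have sd : mesh_lt a s d by move=> i /smesh; rewrite lt_min => /andP[].
have sd' : mesh_lt a s d' by move=> i /smesh; rewrite lt_min => /andP[].
have := ltrD (dL _ sab sd) (dL' _ sab sd').
rewrite -splitr [X in _ + X]distrC ltNge => /negP[].
by rewrite /e (le_trans _ (ler_normD _ _))// addrA subrK.
Qed.

Lemma symplectic_areaE a b g L : a <= b ->
  is_symplectic_area a b g L -> symplectic_area a b g = L.
Proof.
move=> ab gL; apply: (is_symplectic_area_unique ab _ gL).
by apply: (getPex (P := is_symplectic_area a b g)); exists L.
Qed.

(** The error of a sum of chords is additive over the intervals of the
    partition, so an additive candidate only has to be tested on small
    intervals. *)
Lemma is_symplectic_area_primitive a b g (A : R -> R) :
  (forall e, 0 < e -> exists2 d, 0 < d & forall s, itv_partition a b s ->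
     mesh_lt a s d ->
     partition_sum (fun x y => `|A y - A x - chord g x y|) a s < e) ->
  is_symplectic_area a b g (A b - A a).
Proof.
move=> h e /h[d d0 hd]; exists d => // s sab sd.
have [_ /eqP <-] := sab; rewrite -partition_sum_telescope area_sumE -mulN1r.
rewrite -partition_sumZ -partition_sumD (le_lt_trans (norm_partition_sum _ _ _))//.
by under eq_fun do under eq_fun do rewrite mulN1r; exact: hd.
Qed.

Lemma chord_segment (p q : plane R n) (x y : R) :
  omega (p + x *: (q - p)) (p + y *: (q - p)) = (y - x) * omega p q.
Proof.
rewrite !(omegaDl, omegaDr, omegaZl, omegaZr, omegaNl, omegaNr) !omegaxx.
by rewrite (omegaC q p); ring.
Qed.

Lemma close_curve_gt1 g x : 1 <= x ->
  close_curve g x = g 1 + (x - 1) *: (g 0 - g 1).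
Proof.
rewrite /close_curve le_eqVlt => /predU1P[<-|x1].
  by rewrite lexx subrr scale0r addr0.
by rewrite leNgt x1.
Qed.

Lemma partition_sum_close_curve g x s : 1 <= x -> itv_partition x 2 s ->
  partition_sum (chord (close_curve g)) x s =
  (2 - x) * (2^-1 * omega (g 1) (g 0)).
Proof.
elim: s x => [|y s IH] x x1 xs /=.
  by rewrite (itv_partition_nil xs) subrr mul0r.
have xy : x < y by case: xs => /= /andP[].
have y1 : 1 <= y by rewrite (le_trans x1)// ltW.
rewrite IH//; last exact: itv_partition_cons xs.
by rewrite /chord !close_curve_gt1// chord_segment; ring.
Qed.

(** Closing a curve with a segment adds the area of one chord: along the
    segment sums of chords are exact, and in the only interval that contains
    1 in its interior the error is controlled by the continuity of g at 1. *)
Lemma is_symplectic_area_close_curve g L :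
  (forall e, 0 < e -> exists2 d, 0 < d &
     forall x, 0 <= x <= 1 -> 1 - x < d -> edist (g x) (g 1) <= e) ->
  is_symplectic_area 0 1 g L ->
  is_symplectic_area 0 2 (close_curve g) (L + 2^-1 * omega (g 1) (g 0)).
Proof.
move=> g1 gL e e0; have e20 : 0 < e / 2 by rewrite divr_gt0.
have [d d0 hd] := gL _ e20.
pose D := edist (g 0) (g 1).
have D0 : 0 < D + 1 by rewrite ltr_wpDl ?ltr01 ?edist_ge0.
have [|d' d'0 hd'] := g1 (e / 2 / (D + 1)); first by rewrite divr_gt0.
exists (Num.min d d') => [|s s02 sd]; first by rewrite lt_min d0.
have split_at_1 a : 0 <= a -> a < 1 -> itv_partition a 2 s ->
    mesh_lt a s (Num.min d d') ->
    exists s1, [/\ itv_partition a 1 s1, mesh_lt a s1 d &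
      `|partition_sum (chord (close_curve g)) a s - partition_sum (chord g) a s1
        - 2^-1 * omega (g 1) (g 0)| <= e / 2].
  clear s02 sd; elim: s a => [|x s IH] a a0 a1 as2.
    by have a2 : a = 2 := itv_partition_nil as2; lra.
  have ax : a < x by case: as2 => /= /andP[].
  have xs := itv_partition_cons as2.
  move=> /mesh_lt_cons[]; rewrite lt_min => /andP[xad xad'] sd.
  have ga : close_curve g a = g a by rewrite /close_curve ltW.
  have [x1|x1] := ltP x 1.
    have [s1 [[ps1 ls1] ms1 es1]] := IH x (le_trans a0 (ltW ax)) x1 xs sd.
    exists (x :: s1); split => /=; first by split => //=; rewrite ax.
      by apply/mesh_lt_cons; split.
    have -> : chord (close_curve g) a x = chord g a x.
      by rewrite /chord ga (_ : close_curve g x = g x)// /close_curve ltW.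
    by rewrite opprD addrACA subrr add0r.
  exists [:: 1]; split; first exact: itv_partition1.
    by apply/mesh_lt_cons; split => //; lra.
  rewrite /= partition_sum_close_curve// addr0 {1 2}/chord ga close_curve_gt1//.
  (* The point of parameter x is on the segment from [g 1] to [g 0], so cutting
     the corner at [g 1] costs a multiple of the area of this triangle. *)
  rewrite (_ : _ - _ = 2^-1 * (x - 1) * omega (g a - g 1) (g 0 - g 1)); last first.
    rewrite !(omegaDl, omegaDr, omegaZl, omegaZr, omegaNl, omegaNr) omegaxx.
    by ring.
  have x2 : x <= 2 by exact: itv_partition_le xs.
  rewrite normrM ger0_norm; last by lra.
  have h := @norm_omega_sub_le _ _ (g a) (g 1) (g 0) (g 1) (e / 2 / (D + 1)) D.
  rewrite (le_trans (ler_wpM2l _ (h _ _)))//; [by lra| |].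
    by apply: hd'; [rewrite a0 ltW | lra].
  have q0 : 0 <= e / 2 / (D + 1) by rewrite ltW ?divr_gt0.
  have : e / 2 / (D + 1) * (D + 1) = e / 2 by rewrite divfK// gt_eqF.
  have D1 : 0 <= D by exact: edist_ge0.
  move: q0 D1; move: (e / 2 / (D + 1)) => q q0 D1; rewrite mulrDr mulr1 => qD.
  by have := mulr_ge0 q0 D1; move: (q * D) qD => qD; nra.
have [s1 [ps1 ms1 es1]] := split_at_1 0 (lexx _) ltr01 s02 sd.
have := hd _ ps1 ms1; rewrite !area_sumE.
move: es1; set P := partition_sum _ _ _; set P' := partition_sum _ _ _.
set w := _ * omega _ _ => h1 h2.
rewrite (_ : _ - P = (L - P') - (P - P' - w)); last by ring.
by rewrite (le_lt_trans (ler_normB _ _))// [e]splitr ltr_leD.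
Qed.

End Area.

(** * Piecewise linear curves *)

(** Between two consecutive breakpoints that lie in ]a, b[ the function f moves
    by at most e, and there is one more gap than there are breakpoints. *)
Lemma norm_sub_le_breakpoints {R : realFieldType} (f : R -> R) (X : seq R)
    (a b e : R) : a <= b ->
  (forall x y, a <= x -> x <= y -> y <= b -> {in X, forall c, ~~ (x < c < y)} ->
     `|f y - f x| <= e) ->
  `|f b - f a| <= (1 + count (fun c => (a < c < b)%R) X)%:R * e.
Proof.
have [k] := ubnP (count (fun c => (a < c < b)%R) X).
elim: k a b => // k IH a b /ltnSE ck ab fe.
have e0 : 0 <= e.
  have := fe a a (lexx _) (lexx _) ab; rewrite subrr normr0; apply.
  by move=> c _; apply/negP => /andP[ac /(lt_trans ac)]; rewrite ltxx.
have [/hasP[c cX /andP[ac cb]]|/hasPn Xab] := boolP (has (fun c => a < c < b) X);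
    last first.
  rewrite (le_trans (fe a b _ _ _ _))// -[leLHS]mul1r ler_wpM2r// ler1n.
  by rewrite add1n.
have split_count :
    (count (fun x => (a < x < c)%R) X + count (fun x => (c < x < b)%R) X <
    count (fun x => (a < x < b)%R) X)%N.
  elim: X cX {IH ck fe} => //= x X IH; rewrite inE => cX.
  have le_c y : ((a < y < c)%R + (c < y < b)%R <= (a < y < b)%R)%N.
    by case: (ltgtP y c) => yc; rewrite ?andbF ?andbT ?addn0 ?add0n//=;
      [rewrite (lt_trans yc cb) andbT|rewrite (lt_trans ac yc)].
  rewrite addnACA; case/predU1P: cX => [<-{x IH}|/IH{}IH].
  - rewrite !ltxx ac cb/= ?andbF ?add0n add1n ltnS.
    by elim: X => //= x X IH; rewrite addnACA leq_add.
  - by rewrite -addnS leq_add.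
have := IH a c; have := IH c b.
move=> /(_ _ (ltW cb)) h1 /(_ _ (ltW ac)) h2.
rewrite -(subrKA (f c)) (le_trans (ler_normD _ _))//.
apply: le_trans (lerD (h1 _ _) (h2 _ _)) _.
- by rewrite (leq_trans _ ck)// (leq_ltn_trans _ split_count)// leq_addl.
- by move=> x y cx xy yb; apply: fe => //; rewrite (le_trans (ltW ac)).
- by rewrite (leq_trans _ ck)// (leq_ltn_trans _ split_count)// leq_addr.
- by move=> x y cx xy yb; apply: fe => //; rewrite (le_trans yb)// ltW.
rewrite -mulrDl -natrD ler_wpM2r// ler_nat addnACA addnC [(_ + (1 + 1))%N]addnC.
by rewrite -addnA leq_add2l add1n addnC.
Qed.

Section PiecewiseLinear.
Context {R : realType} {n : nat}.
Implicit Types (s x y : R) (p q : plane R n) (l : seq (R * plane R n)).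

(** The area swept from the first node along the interpolation; the first
    branch covers the times before [s], where the curve is constant, because
    [omega p p = 0]. *)
Fixpoint pl_primitive s p l x : R :=
  if l is (s', p') :: l' then
    if x <= s' then 2^-1 * omega p (pl_interp s p l x)
    else 2^-1 * omega p p' + pl_primitive s' p' l' x
  else 0.

Lemma pl_interp_le s p l x : x <= s -> pl_interp s p l x = p.
Proof. by case: l => [//|[s' p'] l] /= ->. Qed.

Lemma pl_primitive_le s p l x : path <%R s (unzip1 l) -> x <= s ->
  pl_primitive s p l x = 0.
Proof.
case: l => [//|[s' p'] l] /= /andP[ss' _] xs.
by rewrite xs (le_trans xs (ltW ss')) omegaxx mulr0.
Qed.

Lemma pl_interp_ge s p s' p' l x : s < s' -> s' <= x ->
  pl_interp s p ((s', p') :: l) x = pl_interp s' p' l x.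
Proof.
move=> ss' s'x /=; rewrite leNgt (lt_le_trans ss' s'x)/=.
have [xs'|//] := leP x s'; have -> : x = s' by apply/le_anti; rewrite xs'.
by rewrite divff ?subr_eq0 ?gt_eqF// scale1r addrC subrK pl_interp_le.
Qed.

Lemma pl_interp_mid s p s' p' l x : s < s' -> s <= x -> x <= s' ->
  pl_interp s p ((s', p') :: l) x = p + ((x - s) / (s' - s)) *: (p' - p).
Proof.
move=> ss' sx xs' /=; rewrite xs'; case: leP => // xs.
have -> : x = s by apply/le_anti; rewrite xs.
by rewrite subrr mul0r scale0r addr0.
Qed.

Lemma pl_primitive_ge s p s' p' l x : path <%R s (unzip1 ((s', p') :: l)) ->
  s' <= x ->
  pl_primitive s p ((s', p') :: l) x = 2^-1 * omega p p' + pl_primitive s' p' l x.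
Proof.
move=> pl s'x; have /andP[ss' pl'] := pl.
rewrite -[LHS]/(if x <= s' then 2^-1 * omega p (pl_interp s p ((s', p') :: l) x)
  else 2^-1 * omega p p' + pl_primitive s' p' l x).
have [xs'|//] := leP x s'.
by rewrite pl_interp_ge// pl_interp_le// pl_primitive_le// addr0.
Qed.

(** On an interval without nodes the curve runs along a line, so that one chord
    computes the area exactly. *)
Lemma pl_primitive_chord s p l x y : path <%R s (unzip1 l) -> x <= y ->
  {in s :: unzip1 l, forall c, ~~ (x < c < y)} ->
  pl_primitive s p l y - pl_primitive s p l x = chord (pl_interp s p l) x y.
Proof.
elim: l s p => [|[s' p'] l IH] s p pl xy nodes.
  by rewrite subrr /chord /= omegaxx mulr0.
have /andP[ss' pl'] := pl.
have [ys'|s'y] := leP y s'.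
  have xs' := le_trans xy ys'.
  have E z : z <= s' -> pl_primitive s p ((s', p') :: l) z =
      2^-1 * omega p (pl_interp s p ((s', p') :: l) z) by move=> /= ->.
  rewrite !E// /chord -mulrBr; congr (_ * _).
  have [ys|sy] := leP y s.
    by rewrite !pl_interp_le ?(le_trans xy)// !omegaxx subrr.
  have sx : s <= x.
    by have := nodes s (mem_head _ _); rewrite sy andbT -leNgt.
  have sy' := ltW sy; rewrite !pl_interp_mid// chord_segment.
  by rewrite !(omegaDr, omegaZr, omegaNr, omegaxx); ring.
have s'x : s' <= x.
  by have := nodes s'; rewrite !inE eqxx orbT s'y andbT -leNgt; exact.
rewrite !pl_primitive_ge// ?(le_trans s'x)// /chord !pl_interp_ge ?(le_trans s'x)//.
rewrite opprD addrACA subrr add0r IH// => c cl; apply: nodes.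
by rewrite inE cl orbT.
Qed.

Lemma pl_interp_lipschitz s p l : path <%R s (unzip1 l) ->
  exists2 M : R, 0 <= M & forall x y, x <= y ->
    edist (pl_interp s p l x) (pl_interp s p l y) <= M * (y - x).
Proof.
elim: l s p => [|[s' p'] l IH] s p.
  by exists 0 => // x y _; rewrite /= edistxx mul0r.
move=> pl; have /andP[ss' /(IH _ p')[M M0 hM]] := pl.
have N0 : 0 <= edist p' p / (s' - s) by rewrite divr_ge0// subr_ge0 ltW.
exists (edist p' p / (s' - s) + M) => [|x y xy]; first exact: addr_ge0.
have first_piece u v : u <= v -> v <= s' ->
    edist (pl_interp s p ((s', p') :: l) u) (pl_interp s p ((s', p') :: l) v) <=
    edist p' p / (s' - s) * (v - u).
  move=> uv vs'; have [vs|sv] := leP v s.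
    by rewrite !pl_interp_le ?(le_trans uv)// edistxx mulr_ge0// subr_ge0.
  rewrite [in X in edist _ X]pl_interp_mid//; last exact: ltW.
  have [us|su] := leP u s.
    rewrite pl_interp_le// edistC /edist addrC addKr enormZ -/(edist _ _).
    rewrite ger0_norm; last by rewrite divr_ge0// subr_ge0 ltW.
    rewrite mulrAC [_ * edist _ _]mulrC mulrAC.
    by rewrite ler_wpM2l// lerD2l lerN2.
  rewrite pl_interp_mid//; [|exact: ltW|exact: le_trans vs'].
  rewrite edistC /edist opprD addrACA subrr add0r -scalerBl enormZ -/(edist _ _).
  rewrite -mulrBl ger0_norm; last first.
    by rewrite divr_ge0 ?subr_ge0 ?lerD2r// ltW.
  by rewrite opprB addrA subrK [leLHS]mulrC mulrA mulrAC.
have [ys'|s'y] := leP y s'.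
  rewrite (le_trans (first_piece _ _ xy ys'))// mulrDl lerDl.
  by rewrite mulr_ge0// subr_ge0.
have [s'x|xs'] := leP s' x.
  rewrite !pl_interp_ge// ?(le_trans s'x)// mulrDl (le_trans (hM _ _ xy))// lerDr.
  by rewrite mulr_ge0// subr_ge0.
have last_piece : edist (pl_interp s p ((s', p') :: l) s')
    (pl_interp s p ((s', p') :: l) y) <= M * (y - s').
  by rewrite !pl_interp_ge ?(ltW s'y)//; apply: hM; exact: ltW.
rewrite (le_trans (edist_triangle (pl_interp s p ((s', p') :: l) s') _ _))//.
rewrite (le_trans (lerD (first_piece _ _ (ltW xs') (lexx _)) last_piece))//.
by rewrite mulrDl; apply: lerD; rewrite ler_wpM2l// ?lerD2r ?lerD2l ?lerN2 ltW.
Qed.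

Lemma edist_convex (c : R) p p' q (r : R) : 0 <= c <= 1 ->
  edist p q <= r -> edist p' q <= r -> edist (p + c *: (p' - p)) q <= r.
Proof.
move=> /andP[c0 c1] pq p'q.
have -> : edist (p + c *: (p' - p)) q = enorm ((1 - c) *: (p - q) + c *: (p' - q)).
  by congr enorm; apply/matrixP => i j; rewrite !mxE; ring.
rewrite (le_trans (ler_enormD _ _))// !enormZ !ger0_norm ?subr_ge0//.
rewrite (le_trans (lerD (ler_wpM2l _ pq) (ler_wpM2l _ p'q)))// ?subr_ge0//.
by rewrite -mulrDl subrK mul1r.
Qed.

(** The interpolation stays within any ball that contains the two nodes around
    the given time. *)
Lemma pl_interp_between s p l x :
  path <%R s (unzip1 l) -> s <= x -> x <= last s (unzip1 l) ->
  exists c d, [/\ c \in (s, p) :: l, d \in (s, p) :: l, c.1 <= x <= d.1,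
    {in s :: unzip1 l, forall k, (k <= c.1) || (d.1 <= k)} &
    forall q r, edist c.2 q <= r -> edist d.2 q <= r ->
      edist (pl_interp s p l x) q <= r].
Proof.
elim: l s p => [|[s' p'] l IH] s p pl sx xl.
  exists (s, p), (s, p); split; rewrite ?mem_head//= ?sx//.
  by move=> k; rewrite inE => /eqP ->; rewrite lexx.
have /andP[ss' pl'] := pl.
have s'l : {in unzip1 l, forall k, s' < k}.
  by apply/allP; rewrite order_path_min//; exact: lt_trans.
have [xs'|s'x] := leP x s'.
  exists (s, p), (s', p'); split; rewrite ?mem_head//= ?sx//.
  - by rewrite !inE eqxx orbT.
  - move=> k; rewrite !inE => /or3P[/eqP->|/eqP->|/s'l s'k]; rewrite ?lexx ?orbT//.
    by rewrite (ltW s'k) orbT.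
  - move=> q r pq p'q.
    rewrite -/(pl_interp s p ((s', p') :: l) x) pl_interp_mid//.
    apply: edist_convex => //; rewrite divr_ge0 ?subr_ge0//= ?(ltW ss')//.
    by rewrite ler_pdivrMr ?subr_gt0// mul1r lerD2r.
have [c [d [cl dl cxd nodes conv]]] := IH s' p' pl' (ltW s'x) xl.
exists c, d; split => //.
- by rewrite inE cl orbT.
- by rewrite inE dl orbT.
- move=> k; rewrite inE => /predU1P[->|]; last exact: nodes.
  rewrite (le_trans (ltW ss'))//; move: cl; rewrite inE => /predU1P[->//|cl].
  by rewrite ltW// s'l//; apply: map_f.
- by rewrite pl_interp_ge// ltW.
Qed.

(** The interpolation is Lipschitz, so the area between it and one of its chords
    is quadratic in the length of the time interval. *)
Lemma is_symplectic_area_pl s p l a b : path <%R s (unzip1 l) -> a <= b ->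
  is_symplectic_area a b (pl_interp s p l)
    (pl_primitive s p l b - pl_primitive s p l a).
Proof.
move=> pl ab; have [M M0 hM] := pl_interp_lipschitz p pl.
set g := pl_interp s p l; set A := pl_primitive s p l.
pose c : R := (1 + size (s :: unzip1 l))%:R * M ^+ 2.
have c0 : 0 <= c by rewrite mulr_ge0 ?sqr_ge0.
have chord_error x y : x <= y -> `|A y - A x - chord g x y| <= c * (y - x) ^+ 2.
  move=> xy; pose f z := A z - 2^-1 * omega (g x) (g z).
  have -> : A y - A x - chord g x y = f y - f x by rewrite /f omegaxx /chord; ring.
  rewrite (le_trans (@norm_sub_le_breakpoints _ f (s :: unzip1 l) x y
    ((M * (y - x)) ^+ 2) xy _))//.
    move=> u v xu uv vy nodes.
    have -> : f v - f u = 2^-1 * omega (g u - g x) (g v - g u).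
      have := pl_primitive_chord p pl uv nodes; rewrite -/g -/A /chord /f => Auv.
      rewrite !(omegaDl, omegaDr, omegaNl, omegaNr) omegaxx.
      have -> : A v = A u + 2^-1 * omega (g u) (g v) by rewrite -Auv; ring.
      by ring.
    have h u' v' : x <= u' -> u' <= v' -> v' <= y ->
        edist (g v') (g u') <= M * (y - x).
      move=> xu' uv' vy'; rewrite edistC (le_trans (hM _ _ uv'))// ler_wpM2l//.
      by rewrite lerB.
    rewrite normrM ger0_norm ?invr_ge0//.
    rewrite (@le_trans _ _ (1 * `|omega (g u - g x) (g v - g u)|))//.
      by rewrite ler_wpM2r//; lra.
    by rewrite mul1r expr2 norm_omega_sub_le// h// (le_trans uv).
  rewrite exprMn mulrA ler_wpM2r ?sqr_ge0// ler_wpM2r ?sqr_ge0// ler_nat leq_add2l.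
  exact: count_size.
apply: is_symplectic_area_primitive => e e0.
have D0 : 0 < c * (b - a) + 1 by rewrite ltr_wpDl ?mulr_ge0 ?subr_ge0.
pose d := e / (c * (b - a) + 1); have d0 : 0 < d by rewrite divr_gt0.
exists d => // r rab mr; apply: (@le_lt_trans _ _ (c * d * (b - a))).
  have [_ /eqP lb] := rab; rewrite -[in leRHS]lb.
  rewrite -(partition_sum_telescope id) -partition_sumZ.
  apply: (partition_sum_mesh rab mr) => x y _ xy _ yx.
  rewrite (le_trans (chord_error _ _ (ltW xy)))// expr2 mulrA.
  by rewrite ler_wpM2r ?subr_ge0 ?(ltW xy)// ler_wpM2l// ltW.
have <- : d * (c * (b - a) + 1) = e by rewrite divfK// gt_eqF.
by rewrite mulrAC mulrC ltr_pM2l// ltrDl.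
Qed.

End PiecewiseLinear.

(** * Curves carried by a tree of intervals *)

Section Tiling.
Context {R : realType} {T : eqType}.
Implicit Types (s t x y : R) (v w : T).

(** A patchwork seen in the parameter: [G i] lists the vertices of generation i,
    [ch v] the children of [v], and [v] carries the interval [[lo v, hi v]]. *)
Record tiling (mu : R) (G : nat -> seq T) (lo hi : T -> R) (ch : T -> seq T) :
    Prop := Tiling {
  tile_uniq : forall i, uniq (G i);
  tile_lt : forall i v, v \in G i -> [/\ 0 <= lo v, lo v < hi v & hi v <= 1];
  tile_disjoint : forall i v w, v \in G i -> w \in G i -> v != w ->
    hi v <= lo w \/ hi w <= lo v;
  tile_cover : forall i x, 0 <= x <= 1 -> exists2 v, v \in G i & lo v <= x <= hi v;
  tile_root : exists2 v, v \in G 0 & lo v = 0 /\ hi v = 1;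
  tile_parent : forall i w, w \in G i.+1 ->
    exists2 v, v \in G i & [/\ w \in ch v, lo v <= lo w & hi w <= hi v];
  tile_degree : forall i v, v \in G i -> (size (ch v))%:R <= mu }.

Context {mu : R} {G : nat -> seq T} {lo hi : T -> R} {ch : T -> seq T}.
Hypothesis tl : tiling mu G lo hi ch.

Definition tile_mid v := (lo v + hi v) / 2.

Definition meets s t v := (s <= hi v) && (lo v <= t).

Lemma tile_mid_in i v : v \in G i -> lo v < tile_mid v < hi v.
Proof. by move=> /(tile_lt tl)[_ h _]; rewrite /tile_mid; apply/andP; split; lra. Qed.

Lemma tile_interior_eq i v w x : v \in G i -> w \in G i ->
  lo v <= x <= hi v -> lo w < x < hi w -> v = w.
Proof.
move=> vi wi /andP[vx xv] /andP[wx xw]; apply/eqP/contraT => vw.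
by have [h|h] := tile_disjoint tl vi wi vw; move: h; rewrite leNgt;
  [rewrite (lt_le_trans wx)|rewrite (le_lt_trans vx)].
Qed.

(** The interval that covers a point slightly to the right of x, before the next
    left endpoint. *)
Lemma tile_cover_right i x : 0 <= x < 1 ->
  exists2 v, v \in G i & lo v <= x < hi v.
Proof.
move=> /andP[x0 x1].
have [y [xy y1 gap]] : exists y, [/\ x < y, y <= 1 &
    {in G i, forall w, lo w <= x \/ y <= lo w}].
  elim: (G i) => [|w r [y [xy y1 gap]]]; first by exists 1.
  have [wx|xw] := leP (lo w) x.
    by exists y; split=> // u; rewrite inE => /predU1P[->|/gap//]; left.
  exists (Num.min y (lo w)); split => [||u].
  - by rewrite lt_min xy.
  - by rewrite ge_min y1.
  - rewrite inE => /predU1P[->|/gap[|yu]]; [|by left|]; right.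
      by rewrite ge_min lexx orbT.
    by rewrite ge_min yu.
have [|v vi /andP[vz zv]] := @tile_cover _ _ _ _ _ tl i ((x + y) / 2).
  by apply/andP; split; lra.
exists v => //; have [->|] := gap v vi; lra.
Qed.

Lemma tile_next i v : v \in G i -> hi v < 1 -> exists2 u, u \in G i & lo u = hi v.
Proof.
move=> vi v1; have [v0 vv _] := tile_lt tl vi.
have [|u ui /andP[uv vu]] := @tile_cover_right i (hi v).
  by rewrite v1 andbT (le_trans v0)// ltW.
exists u => //; apply/le_anti; rewrite uv/=.
have /(tile_disjoint tl vi ui)[//|uv'] : v != u.
  by apply/eqP => e; rewrite e ltxx in vu.
by have := lt_le_trans (lt_trans vv vu) uv'; rewrite ltxx.
Qed.

Lemma tile_ancestor i j w : w \in G (i + j)%N ->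
  exists2 v, v \in G i & lo v <= lo w /\ hi w <= hi v.
Proof.
elim: j w => [|j IH] w; first by rewrite addn0 => wi; exists w.
rewrite addnS => /(tile_parent tl)[u /IH[v vi [vu uv]] [_ uw wu]].
by exists v => //; split; [exact: le_trans uw|exact: le_trans uv].
Qed.

Lemma ler_sum_mem (r : seq T) (P : pred T) (F : T -> R) v :
  v \in r -> P v -> (forall w, w \in r -> 0 <= F w) ->
  F v <= \sum_(w <- r | P w) F w.
Proof.
move=> vr Pv F0; rewrite big_mkcond (big_rem v)//= Pv lerDl big_seq.
by apply: sumr_ge0 => w /mem_rem /F0; case: ifP.
Qed.

(** Walking from s to t through consecutive intervals of one generation. *)
Lemma norm_sub_le_tiles i (f : R -> R) (e : T -> R) s t :
  (forall v x y, v \in G i -> lo v <= x -> x <= y -> y <= hi v ->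
     `|f y - f x| <= e v) ->
  0 <= s -> s <= t -> t <= 1 ->
  `|f t - f s| <= \sum_(v <- G i | meets s t v) e v.
Proof.
move=> fe s0 st t1; have e0 v : v \in G i -> 0 <= e v.
  move=> vi; have [_ vv _] := tile_lt tl vi.
  by have := fe v (lo v) (lo v) vi (lexx _) (lexx _) (ltW vv); apply: le_trans.
apply: (@le_trans _ _ (\sum_(v <- G i | (s < hi v) && (lo v <= t)) e v)); last first.
  rewrite big_mkcond [leRHS]big_mkcond big_seq [leRHS]big_seq; apply: ler_sum => v vi.
  by rewrite /meets; case: (ltgtP s (hi v)); case: (lo v <= t); rewrite //= e0.
have [k] := ubnP (count (fun v => (s < hi v)%R) (G i)).
elim: k s s0 st => // k IH s s0 st /ltnSE ck.
have sum0 : 0 <= \sum_(v <- G i | (s < hi v) && (lo v <= t)) e v.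
  by rewrite big_seq_cond; apply: sumr_ge0 => v /andP[/e0].
have [<-|s_neq_t] := eqVneq s t; first by rewrite subrr normr0 big_seq_cond
   sumr_ge0// => v /andP[/e0].
have slt : s < t by rewrite lt_def eq_sym s_neq_t.
have [|v vi /andP[vs sv]] := @tile_cover_right i s.
  by rewrite s0 (lt_le_trans slt).
have [tv|vt] := leP t (hi v).
  apply: (le_trans (fe v s t vi vs st tv)).
  by apply: ler_sum_mem => //; rewrite sv (le_trans vs).
rewrite -(subrKA (f (hi v))) (le_trans (ler_normD _ _))// addrC.
rewrite -big_filter (bigD1_seq v) ?filter_uniq ?(tile_uniq tl)//=; last first.
  by rewrite mem_filter sv vi (le_trans vs).
apply: lerD; first by apply: fe => //; exact: ltW.
apply: le_trans (IH _ _ (ltW vt) _) _.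
- by rewrite (le_trans s0)// ltW.
- rewrite (leq_trans _ ck)//; elim: (G i) vi => //= u r IHr.
  have le_u : forall w, ((hi v < hi w)%R <= (s < hi w)%R)%N.
    by move=> w; case: (ltP (hi v) (hi w)) => // /(lt_trans sv) ->.
  rewrite inE => /predU1P[<-|/IHr{}IHr]; last by rewrite -addnS leq_add.
  rewrite ltxx sv add0n add1n ltnS; elim: r {IHr} => //= w r IHr.
  exact: leq_add.
rewrite big_filter_cond big_mkcond [leRHS]big_mkcond.
rewrite big_seq [leRHS]big_seq; apply: ler_sum => w wi.
have [vw|wv] := ltP (hi v) (hi w).
  have -> : w != v by apply: contraTneq vw => ->; rewrite ltxx.
  rewrite (lt_trans sv vw)/=.
  by rewrite andbT.
by rewrite /=; case: ifP => // _; exact: e0.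
Qed.

Lemma tile_width i : exists2 r : R, 0 < r &
  forall m v, (m <= i)%N -> v \in G m -> r <= hi v - lo v.
Proof.
have one m : exists2 r : R, 0 < r & forall v, v \in G m -> r <= hi v - lo v.
  have : {in G m, forall v, lo v < hi v} by move=> v /(tile_lt tl)[].
  elim: (G m) => [|u r IH] h; first by exists 1.
  have [|d d0 hd] := IH; first by move=> v vr; apply: h; rewrite inE vr orbT.
  exists (Num.min d (hi u - lo u)) => [|v].
    by rewrite lt_min d0 subr_gt0 h ?mem_head.
  rewrite inE => /predU1P[->|/hd vd]; first by rewrite ge_min lexx orbT.
  by rewrite ge_min vd.
elim: i => [|i [r r0 hr]].
  by have [r r0 hr] := one 0%N; exists r => // m v; rewrite leqn0 => /eqP ->; exact: hr.
have [d d0 hd] := one i.+1; exists (Num.min r d) => [|m v]; first by rewrite lt_min r0.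
rewrite leq_eqVlt => /predU1P[->|mi] vm; rewrite ge_min; first by rewrite hd ?orbT.
by rewrite (hr m).
Qed.

(** ** The intervals of a partition and the tree *)

(** The weight of [w] in the area over an interval [[s, t]] of a partition. It is
    at least 1 for every vertex that contributes to this area, and its sum over
    the intervals of any partition is bounded, because a point lies in at most
    two of them. *)
Definition charge w s t : R :=
  (s <= lo w <= t)%R%:R + (s <= hi w <= t)%R%:R +
  \sum_(u <- ch w) (s <= lo u <= t)%R%:R.

Lemma charge_ge0 w s t : 0 <= charge w s t.
Proof. by rewrite !addr_ge0// sumr_ge0. Qed.

Lemma partition_sum_charge i w a r : w \in G i -> path <%R a r ->
  partition_sum (charge w) a r <= 4 + 2 * mu.
Proof.
move=> wi pr; rewrite /charge !partition_sumD partition_sum_sum.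
have -> : 4 + 2 * mu = 2 + 2 + 2 * mu by rewrite -natrD.
rewrite !lerD// ?partition_sum_mem_le2//.
rewrite (@le_trans _ _ (\sum_(u <- ch w) 2))//.
  by apply: ler_sum => u _; exact: partition_sum_mem_le2.
rewrite big_const_seq count_predT iter_addr_0 -[leLHS]mulr_natr.
by rewrite ler_wpM2l// (tile_degree tl wi).
Qed.

(** Let k be the first generation with an interval inside [[s, t]]. Then q, the
    generation before k (or 0 if k = 0), has two adjacent intervals that cover
    [[s, t]], and every vertex of generation at least q that meets [[s, t]] is
    charged: either one of its endpoints lies in [[s, t]], or it strictly
    contains [[s, t]]; in that case it is the parent of a vertex of generation
    k inside [[s, t]]. *)
Lemma exists_start_generation s t : 0 <= s -> s < t -> t <= 1 ->
  (exists k w, [/\ w \in G k, s <= lo w & hi w <= t]) ->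
  exists q k, [/\ (q <= k <= q.+1)%N,
    (exists w, [/\ w \in G k, s <= lo w & hi w <= t]),
    (exists v u, [/\ v \in G q, u \in G q, lo v <= s <= hi v, lo u <= t <= hi u &
       lo u <= hi v]) &
    forall m w, (q <= m)%N -> w \in G m -> meets s t w -> 1 <= charge w s t].
Proof.
move=> s0 st t1 [k0 ex_w].
have ex_k : exists k, `[< exists w, [/\ w \in G k, s <= lo w & hi w <= t] >].
  by exists k0; apply/asboolP.
case: (ex_minnP ex_k) => k /asboolP[w0 [w0k sw0 w0t]] kmin.
have mid0 := tile_mid_in w0k; have /andP[lo_mid mid_hi] := mid0.
have charged m w : w \in G m -> meets s t w ->
    (k <= m)%N || (k == m.+1) -> 1 <= charge w s t.
  move=> wm /andP[sw wt] km; rewrite /charge.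
  have [slo|los] := leP s (lo w).
    by rewrite wt/= -addrA lerDl addr_ge0// sumr_ge0.
  have [hit|thi] := leP (hi w) t; first by rewrite sw/= add0r lerDl sumr_ge0.
  rewrite andbF !add0r; case/orP: km => [km|/eqP km].
    have [v vk [vw wv]] : exists2 v, v \in G k & lo v <= lo w /\ hi w <= hi v.
      by apply: (@tile_ancestor k (m - k)); rewrite subnKC.
    have vE : v = w0.
      apply: tile_interior_eq vk w0k _ mid0; apply/andP; split; first by lra.
      by lra.
    by move: vw; rewrite vE; lra.
  move: w0k; rewrite km => /(tile_parent tl)[v vm [w0v vw0 w0hv]].
  have vE : v = w.
    apply: (tile_interior_eq (x := tile_mid w0) vm wm); first by apply/andP; split; lra.
    by apply/andP; split; lra.
  rewrite vE in w0v; rewrite (big_rem w0)//= sw0.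
  have -> : lo w0 <= t by lra.
  by rewrite /= lerDl sumr_ge0.
exists k.-1, k; split.
- by case: (k) => //= j; rewrite leqnSn leqnn.
- by exists w0.
- case: k {charged} kmin w0k mid0 => [|q] kmin _ _ /=.
    have [v v0 [vlo vhi]] := tile_root tl.
    by exists v, v; rewrite vlo vhi; split => //; apply/andP; split; lra.
  have no_tile v : v \in G q -> s <= lo v -> t < hi v.
    move=> vq sv; rewrite ltNge; apply/negP => vt.
    have := kmin q; rewrite ltnn => /(_ _)/negP[]; last by [].
    by apply/asboolP; exists v.
  have [|v vq /andP[vs sv]] := @tile_cover_right q s.
    by rewrite s0 (lt_le_trans st).
  have [tv|vt] := leP t (hi v).
    by exists v, v; split => //; [apply/andP; split|apply/andP; split|]; lra.
  have [|u uq uv] := tile_next vq; first exact: lt_le_trans t1.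
  exists v, u; split => //; rewrite ?uv ?vs ?(ltW sv)// (ltW vt)/= ltW// no_tile//.
  by rewrite uv ltW.
- move=> m w qm wm mw; apply: charged wm mw _.
  case: (k) qm => [//|q] /=; rewrite leq_eqVlt => /predU1P[->|->//].
  by rewrite eqxx orbT.
Qed.

End Tiling.
Arguments tile_mid {R T} lo hi v.
Arguments meets {R T} lo hi s t v.
Arguments charge {R T} lo hi ch w s t.

(** * Areas of successive approximations *)

Lemma ler_geometric_tail {R : realFieldType} (B : R) (N k : nat) (u : nat -> R) :
  (forall j, 0 <= u j <= B * 2 ^- j) ->
  \sum_(j < k) u (N + j)%N <= 2 * B * 2 ^- N.
Proof.
move=> uB; have B0 : 0 <= B.
  by have /andP[u0 /(le_trans u0)] := uB 0%N; rewrite expr0 invr1 mulr1.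
have -> : 2 * B * 2 ^- N = 2 * B * 2 ^- N * 1 by rewrite mulr1.
apply: (@le_trans _ _ (2 * B * 2 ^- N * (1 - 2 ^- k))).
  elim: k => [|k IH]; first by rewrite big_ord0 expr0 invr1 subrr mulr0.
  rewrite big_ord_recr/= (le_trans (lerD IH (andP (uB _)).2))//.
  by rewrite exprD exprS !invfM; nra.
by rewrite ler_wpM2l ?mulr_ge0 ?invr_ge0 ?exprn_ge0// gerBl invr_ge0 exprn_ge0.
Qed.

(** The first N terms are controlled by the sum of their squares, the others by
    the geometric bound. Choosing N balances the two contributions; this is
    where the logarithm in the area bound comes from. *)
Lemma sqr_sum_le_split {R : realFieldType} (u x : nat -> R) (B : R) (N k : nat) :
  (forall j, 0 <= u j <= B * 2 ^- j) -> (forall j, u j ^+ 2 <= 4 * x j) ->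
  (\sum_(j < k) u j) ^+ 2 <=
    8 * N%:R * (\sum_(j < k) x j) + 8 * B ^+ 2 * 4 ^- N.
Proof.
move=> uB ux; have x0 j : 0 <= x j.
  by have := le_trans (sqr_ge0 _) (ux j); rewrite pmulr_rge0.
have few m : (m <= N)%N -> (\sum_(j < m) u j) ^+ 2 <= 4 * N%:R * \sum_(j < m) x j.
  move=> mN; have := cauchy_schwarz_sum (fun j : 'I_m => u j) (fun=> 1).
  under eq_bigr do rewrite mulr1.
  move=> /le_trans; apply; rewrite sumr_const card_ord expr1n.
  rewrite mulrAC mulr_sumr ler_pM ?ler_nat ?sumr_ge0// => [j _|]; first exact: sqr_ge0.
  by apply: ler_sum => j _.
have tail0 : 0 <= 8 * B ^+ 2 * 4 ^- N.
  by rewrite mulr_ge0 ?invr_ge0 ?exprn_ge0// mulr_ge0 ?sqr_ge0.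
have [kN|Nk] := leqP k N.
  rewrite (le_trans (few k kN))// -[leLHS]addr0 lerD//.
  have : 0 <= N%:R * \sum_(j < k) x j by rewrite mulr_ge0// sumr_ge0.
  by rewrite -!mulrA; lra.
rewrite -(subnKC (ltnW Nk)) !big_split_ord/=.
have := few N (leqnn N); have := @ler_geometric_tail _ B N (k - N) u uB.
have : 0 <= \sum_(j < k - N) u (N + j)%N.
  by apply: sumr_ge0 => j _; case/andP: (uB (N + j)%N).
have : 0 <= \sum_(j < k - N) x (N + j)%N by exact: sumr_ge0.
have : 0 <= N%:R :> R by [].
have -> : 4 ^- N = 2 ^- N ^+ 2 :> R.
  by rewrite exprVn -exprM mulnC exprM -[2 ^+ 2]natrX.
move: (\sum_(j < N) u j) (\sum_(j < N) x j) (\sum_(j < k - N) u (N + j)%N)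
  (\sum_(j < k - N) x (N + j)%N) (2 ^- N) N%:R => a X b Y z M M0 Y0 b0 bz aX.
have b2 : b ^+ 2 <= (2 * B * z) ^+ 2 by rewrite ler_pXn2r ?nnegrE// (le_trans b0).
have := sqr_ge0 (a - b); have := mulr_ge0 M0 Y0; nra.
Qed.

Section CurveFamily.
Context {R : realType} {n : nat} {T : eqType}.
Context {mu : R} {G : nat -> seq T} {lo hi : T -> R} {ch : T -> seq T}.
Hypothesis tl : tiling mu G lo hi ch.
Local Notation mid := (tile_mid lo hi).

(** Of polygonal curves [g i] with nodes at the midpoints of generation [i], the
    proof only uses that one chord computes the area, here the increment of
    [A i], between two nodes. *)
Record curve_family (K : R) (g : nat -> R -> plane R n) (A : nat -> R -> R)
    (delta : T -> R) : Prop := CurveFamily {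
  family_chord : forall i x y, 0 <= x -> x <= y -> y <= 1 ->
    (forall w, w \in G i -> ~~ (x < mid w < y)) ->
    A i y - A i x = chord (g i) x y;
  family_same : forall i v x y, v \in G i -> lo v <= x <= hi v ->
    lo v <= y <= hi v -> edist (g i x) (g i y) <= delta v;
  family_next : forall i v x y, v \in G i -> lo v <= x <= hi v ->
    lo v <= y <= hi v -> edist (g i.+1 x) (g i y) <= delta v;
  family_delta : forall i v, v \in G i -> delta v <= K * 2 ^- i }.

Context {K : R} {g : nat -> R -> plane R n} {A : nat -> R -> R} {delta : T -> R}.
Hypothesis fam : curve_family K g A delta.
Implicit Types (s t x y : R) (v w : T).

(** The area between [g i] on [[s, t]] and its chord. *)
Definition excess i s t : R := A i t - A i s - chord (g i) s t.

Definition local_sigma m s t : R :=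
  \sum_(v <- G m | meets lo hi s t v) delta v ^+ 2.

Definition flux m x : R := A m.+1 x - A m x - 2^-1 * omega (g m x) (g m.+1 x).

Lemma delta_ge0 i v : v \in G i -> 0 <= delta v.
Proof.
move=> vi; have [_ /ltW vv _] := tile_lt tl vi.
by apply: le_trans (family_same fam vi (x := lo v) (y := lo v) _ _); rewrite ?lexx ?vv.
Qed.

Lemma mu_ge0 : 0 <= mu.
Proof. by have [v v0 _] := tile_root tl; exact: le_trans (tile_degree tl v0). Qed.

Lemma local_sigma_ge0 m s t : 0 <= local_sigma m s t.
Proof. by apply: sumr_ge0 => v _; exact: sqr_ge0. Qed.

Lemma ler_local_sigma m v s t : v \in G m -> meets lo hi s t v ->
  delta v ^+ 2 <= local_sigma m s t.
Proof.
by move=> vm mv; apply: (ler_sum_mem (F := fun v => delta v ^+ 2)) => // w _;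
  exact: sqr_ge0.
Qed.

(** On the interval of [v] the two curves consist of boundedly many segments,
    and corresponding segments bound a quadrilateral whose diagonals are at most
    [delta v]. *)
Lemma norm_flux_le m v x y : v \in G m -> lo v <= x -> x <= y -> y <= hi v ->
  `|flux m y - flux m x| <= (2 + mu) / 2 * delta v ^+ 2.
Proof.
move=> vm vx xy yv; have [v0 vv v1] := tile_lt tl vm; have d0 := delta_ge0 vm.
pose X := mid v :: [seq mid w | w <- ch v].
rewrite (le_trans (@norm_sub_le_breakpoints _ _ X _ _ (2^-1 * delta v ^+ 2) xy _))//.
- move=> a b xa ab b_y nodes; have va := le_trans vx xa; have bv := le_trans b_y yv.
  have inside w c : w \in G m -> a < c < b -> lo w <= c <= hi w -> w = v.
    move=> wm /andP[ac cb] cw; apply: (tile_interior_eq tl wm vm cw).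
    by rewrite (le_lt_trans va ac) (lt_le_trans cb bv).
  have mid_in i w : w \in G i -> lo w <= mid w <= hi w.
    by move=> /(tile_mid_in tl)/andP[/ltW-> /ltW->].
  have a0 := le_trans v0 va; have b1 := le_trans bv v1.
  have Am : A m b = A m a + chord (g m) a b.
    rewrite -(family_chord fam a0 ab b1) ?subrKC// => w wm; apply/negP => ac.
    move: (ac); rewrite (inside _ _ wm ac (mid_in _ _ wm)); apply/negP/nodes.
    exact: mem_head.
  have Am' : A m.+1 b = A m.+1 a + chord (g m.+1) a b.
    rewrite -(family_chord fam a0 ab b1) ?subrKC// => w wm; apply/negP => ac.
    have [u um [wu uw wu']] := tile_parent tl wm; have /andP[h1 h2] := mid_in _ _ wm.
    have uv : u = v.
      by apply: (inside u (mid w)) => //; rewrite (le_trans uw)// (le_trans h2).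
    by move: ac; apply/negP/nodes; rewrite inE map_f ?orbT// -uv.
  have -> : flux m b - flux m a =
      - (2^-1 * omega (g m.+1 b - g m a) (g m.+1 a - g m b)).
    rewrite /flux Am Am' /chord !(omegaDl, omegaDr, omegaNl, omegaNr).
    rewrite (omegaC (g m b) (g m.+1 b)) (omegaC (g m.+1 b) (g m.+1 a)).
    by ring.
  have ain : lo v <= a <= hi v by rewrite va (le_trans ab).
  have bin : lo v <= b <= hi v by rewrite bv (le_trans va).
  rewrite normrN normrM ger0_norm ?invr_ge0// ler_wpM2l ?invr_ge0// expr2.
  by apply: norm_omega_sub_le; apply: (family_next fam vm).
- rewrite mulrA ler_wpM2r ?sqr_ge0// ler_wpM2r ?invr_ge0//.
  rewrite (@le_trans _ _ (2 + (size (ch v))%:R))//; last first.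
    by rewrite lerD2l (tile_degree tl vm).
  rewrite -natrD ler_nat (_ : (2 + _ = 1 + size X)%N) ?leq_add2l ?count_size//.
  by rewrite /= size_map.
Qed.

Definition drift m s t : R := edist (g m.+1 s) (g m s) + edist (g m.+1 t) (g m t).

Lemma drift_ge0 m s t : 0 <= drift m s t.
Proof. by rewrite addr_ge0. Qed.

Lemma edist_next_le m s t x : 0 <= s -> s <= t -> t <= 1 -> x = s \/ x = t ->
  edist (g m.+1 x) (g m x) ^+ 2 <= local_sigma m s t /\
  edist (g m.+1 x) (g m x) <= K * 2 ^- m.
Proof.
move=> s0 st t1 xst.
have x01 : 0 <= x <= 1.
  by case: xst => ->; rewrite ?s0 ?t1 ?(le_trans s0)// (le_trans st).
have [v vm /andP[vx xv]] := tile_cover tl m x01.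
have dv : edist (g m.+1 x) (g m x) <= delta v.
  by apply: (family_next fam vm); rewrite vx xv.
split; last exact: le_trans dv (family_delta fam vm).
rewrite (@le_trans _ _ (delta v ^+ 2))//.
  by rewrite ler_pXn2r ?nnegrE// (delta_ge0 vm).
apply: ler_local_sigma => //; rewrite /meets.
by case: xst => xst; apply/andP; split; lra.
Qed.

Lemma sqr_drift_le m s t : 0 <= s -> s <= t -> t <= 1 ->
  drift m s t ^+ 2 <= 4 * local_sigma m s t.
Proof.
move=> s0 st t1; rewrite /drift.
have [hs _] := @edist_next_le m s t s s0 st t1 (or_introl erefl).
have [ht _] := @edist_next_le m s t t s0 st t1 (or_intror erefl).
move: (edist _ _) (edist _ _) hs ht => a b ha hb.
by have := sqr_ge0 (a - b); nra.
Qed.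

Lemma drift_le m s t : 0 <= s -> s <= t -> t <= 1 ->
  drift m s t <= 2 * K * 2 ^- m.
Proof.
move=> s0 st t1; rewrite /drift -mulrA mulr2n mulrDl mul1r lerD//.
  by case: (@edist_next_le m s t s s0 st t1 (or_introl erefl)).
by case: (@edist_next_le m s t t s0 st t1 (or_intror erefl)).
Qed.

(** Replacing [g m] by [g m.+1] changes the excess by the area between the two
    curves and by that of the quadrilateral spanned by their endpoints, which
    has two sides of total length [drift]. *)
Lemma excess_succ m s t : 0 <= s -> s <= t -> t <= 1 ->
  `|excess m.+1 s t - excess m s t - 2^-1 *
     (omega (g m t - g m s) (g m.+1 t - g m t) +
      omega (g m t - g m s) (g m.+1 s - g m s) +
      omega (g m.+1 t - g m t) (g m.+1 s - g m s))|
  <= (2 + mu) / 2 * local_sigma m s t.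
Proof.
move=> s0 st t1; rewrite [leRHS]mulr_sumr.
have := norm_sub_le_tiles tl (f := flux m)
  (e := fun v => (2 + mu) / 2 * delta v ^+ 2) (@norm_flux_le m) s0 st t1.
congr (_ <= _); congr `|_|; rewrite /flux /excess /chord.
rewrite !(omegaDl, omegaDr, omegaNl, omegaNr) !omegaxx.
rewrite ?(omegaC (g m t) (g m s)) ?(omegaC (g m.+1 s) (g m s))
  ?(omegaC (g m.+1 t) (g m s)) ?(omegaC (g m.+1 s) (g m t))
  ?(omegaC (g m.+1 t) (g m t)) ?(omegaC (g m.+1 t) (g m.+1 s)).
by field.
Qed.

Lemma norm_excess_succ_closed m s t : 0 <= s -> s <= t -> t <= 1 ->
  g m s = g m t -> g m.+1 s = g m.+1 t ->
  `|excess m.+1 s t - excess m s t| <= (2 + mu) / 2 * local_sigma m s t.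
Proof.
move=> s0 st t1 e1 e2; have := excess_succ m s0 st t1.
by rewrite e1 e2 subrr !omega0l !add0r omegaxx mulr0 subr0.
Qed.

Lemma norm_excess_succ m s t : 0 <= s -> s <= t -> t <= 1 ->
  `|excess m.+1 s t - excess m s t| <= (2 + mu) / 2 * local_sigma m s t +
     2^-1 * (edist (g m t) (g m s) * drift m s t + drift m s t ^+ 2).
Proof.
move=> s0 st t1; have := excess_succ m s0 st t1.
set w1 := omega _ _; set w2 := omega _ _; set w3 := omega _ _.
have h1 : `|w1| <= edist (g m t) (g m s) * edist (g m.+1 t) (g m t).
  exact: norm_omega_le.
have h2 : `|w2| <= edist (g m t) (g m s) * edist (g m.+1 s) (g m s).
  exact: norm_omega_le.
have h3 : `|w3| <= edist (g m.+1 t) (g m t) * edist (g m.+1 s) (g m s).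
  exact: norm_omega_le.
have e1 := edist_ge0 (g m.+1 t) (g m t); have e2 := edist_ge0 (g m.+1 s) (g m s).
move: h1 h2 h3; rewrite /drift !ler_norml => /andP[? ?] /andP[? ?] /andP[? ?].
by move=> /andP[? ?]; apply/andP; split; nra.
Qed.

Lemma edist_ends_le q k s t :
  edist (g (q + k)%N t) (g (q + k)%N s) <=
  edist (g q t) (g q s) + \sum_(j < k) drift (q + j)%N s t.
Proof.
elim: k => [|k IH]; first by rewrite addn0 big_ord0 addr0.
rewrite big_ord_recr/= addnS addrA.
have h1 := edist_triangle (g (q + k)%N t) (g (q + k).+1 t) (g (q + k).+1 s).
have h2 := edist_triangle (g (q + k)%N s) (g (q + k)%N t) (g (q + k).+1 s).
have h3 := edistC (g (q + k)%N s) (g (q + k).+1 s).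
by rewrite /drift; lra.
Qed.

Lemma norm_excess_telescope q k s t : 0 <= s -> s <= t -> t <= 1 ->
  `|excess (q + k)%N s t - excess q s t| <=
    (2 + mu) / 2 * \sum_(j < k) local_sigma (q + j)%N s t +
    2^-1 * (edist (g q t) (g q s) * \sum_(j < k) drift (q + j)%N s t +
            (\sum_(j < k) drift (q + j)%N s t) ^+ 2).
Proof.
move=> s0 st t1; elim: k => [|k IH].
  by rewrite addn0 !big_ord0 subrr normr0 expr0n !mulr0 !addr0 mulr0.
rewrite !big_ord_recr/= addnS.
have h := norm_excess_succ (q + k)%N s0 st t1.
have hd := edist_ends_le q k s t.
have e0 := drift_ge0 (q + k)%N s t.
have S0 : 0 <= \sum_(j < k) drift (q + j)%N s t.
  by apply: sumr_ge0 => j _; exact: drift_ge0.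
rewrite -(subrKA (excess (q + k)%N s t)) (le_trans (ler_normD _ _))//.
rewrite (le_trans (lerD h IH))// mulrDr.
move: (local_sigma _ _ _) (\sum_(j < k) local_sigma _ _ _) => x X.
move: (drift _ _ _) (\sum_(j < k) _) (edist _ _) (edist _ _) e0 S0 hd {h IH}.
move=> e S b b0 e0 S0 hb.
have := ler_wpM2r e0 hb; have := mulr_ge0 S0 e0; nra.
Qed.

(** At the start generation the curve has at most two nodes on [[s, t]], and its
    image there is covered by that of two adjacent intervals. *)
Lemma excess_start q s t v u : 0 <= s -> s <= t -> t <= 1 ->
  v \in G q -> u \in G q -> lo v <= s <= hi v -> lo u <= t <= hi u ->
  lo u <= hi v ->
  `|excess q s t| <= 12 * local_sigma q s t /\
  edist (g q t) (g q s) ^+ 2 <= 4 * local_sigma q s t.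
Proof.
move=> s0 st t1 vq uq /andP[vs sv] /andP[ut tu] uv.
have dv := delta_ge0 vq; have du := delta_ge0 uq.
pose M := delta v + delta u.
have M2 : M ^+ 2 <= 4 * local_sigma q s t.
  have h1 : delta v ^+ 2 <= local_sigma q s t.
    by apply: ler_local_sigma => //; rewrite /meets sv (le_trans vs).
  have h2 : delta u ^+ 2 <= local_sigma q s t.
    by apply: ler_local_sigma => //; rewrite /meets ut (le_trans st).
  by rewrite /M; have := sqr_ge0 (delta v - delta u); nra.
have near_s x : s <= x -> x <= t -> edist (g q x) (g q s) <= M.
  move=> sx xt; have [xv|vx] := leP x (hi v).
    rewrite (le_trans (family_same fam vq _ _)) ?lerDl ?vs ?sv ?xv ?(le_trans vs)//.
  rewrite (le_trans (edist_triangle (g q (hi v)) _ _))// addrC lerD//.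
    by apply: (family_same fam vq); rewrite ?lexx ?vs ?sv// (le_trans vs sv).
  apply: (family_same fam uq); rewrite ?uv /= ?(le_trans xt tu) ?andbT.
    by rewrite (le_trans uv)// ltW.
  by rewrite (le_trans (ltW vx))// (le_trans xt).
split; last first.
  rewrite (le_trans _ M2)// ler_pXn2r ?nnegrE ?addr_ge0//; exact: near_s.
pose f x := A q x - 2^-1 * omega (g q s) (g q x).
have -> : excess q s t = f t - f s by rewrite /f /excess omegaxx /chord; ring.
rewrite (le_trans (@norm_sub_le_breakpoints _ f [:: mid v; mid u] s t (M ^+ 2) st _))//.
  move=> a b sa ab bt nodes.
  have := family_chord fam (i := q) (le_trans s0 sa) ab (le_trans bt t1).
  have no_nodes w : w \in G q -> ~~ (a < mid w < b).
    move=> wq; apply/negP => cab; have /andP[ac cb] := cab.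
    have midw := tile_mid_in tl wq.
    have [wv|vw] := leP (mid w) (hi v).
      have vw : v = w.
        by apply: (tile_interior_eq tl vq wq _ midw); rewrite wv andbT; lra.
      by move: cab; rewrite -vw; apply/negP; apply: nodes; rewrite mem_head.
    have uw : u = w.
      by apply: (tile_interior_eq tl uq wq _ midw); apply/andP; split; lra.
    by move: cab; rewrite -uw; apply/negP; apply: nodes; rewrite !inE eqxx orbT.
  move=> /(_ no_nodes) Aab.
  have -> : f b - f a = 2^-1 * omega (g q a - g q s) (g q b - g q a).
    have Ab : A q b = A q a + chord (g q) a b by rewrite -Aab subrKC.
    rewrite /f Ab /chord !(omegaDl, omegaDr, omegaNl, omegaNr) omegaxx.
    by ring.
  have h1 : edist (g q a) (g q s) <= M by apply: near_s => //; exact: le_trans bt.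
  have h2 : edist (g q b) (g q a) <= 2 * M.
    have := edist_triangle (g q s) (g q b) (g q a).
    have := near_s b (le_trans sa ab) bt; rewrite (edistC (g q s)); lra.
  have := norm_omega_sub_le h1 h2.
  by rewrite normrM ger0_norm ?invr_ge0//; lra.
have : (1 + count (fun c => (s < c < t)%R) [:: mid v; mid u])%:R <= 3 :> R.
  by rewrite ler_nat (leq_add (leqnn 1) (count_size _ _)).
by move: (_%:R : R) => r r3; have := sqr_ge0 M; nra.
Qed.

(** The constant 14 + mu is the sum of 12 for the start generation, of 1 for the
    drift and the chord at the start generation, and of (2 + mu) / 2 for the
    fluxes, rounded up. *)
Lemma norm_excess_le q k N s t v u : 0 <= s -> s <= t -> t <= 1 ->
  v \in G q -> u \in G q -> lo v <= s <= hi v -> lo u <= t <= hi u ->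
  lo u <= hi v ->
  `|excess (q + k)%N s t| <=
    (14 + mu + 8 * N%:R) * \sum_(j < k.+1) local_sigma (q + j)%N s t +
    32 * K ^+ 2 * 4 ^- q * 4 ^- N.
Proof.
move=> s0 st t1 vq uq vs ut uv.
have [E0 b2] := excess_start s0 st t1 vq uq vs ut uv.
have tel := norm_excess_telescope q k s0 st t1.
have x0 j : 0 <= local_sigma j s t by exact: local_sigma_ge0.
have S2 := @sqr_sum_le_split _ (fun j => drift (q + j)%N s t)
  (fun j => local_sigma (q + j)%N s t) (2 * K * 2 ^- q) N k.
rewrite -(subrK (excess q s t) (excess (q + k)%N s t)).
rewrite (le_trans (ler_normD _ _))// (le_trans (lerD tel E0))//.
have {}S2 : (\sum_(j < k) drift (q + j)%N s t) ^+ 2 <=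
    8 * N%:R * \sum_(j < k) local_sigma (q + j)%N s t +
    32 * K ^+ 2 * 4 ^- q * 4 ^- N.
  have -> : 32 * K ^+ 2 * 4 ^- q = 8 * (2 * K * 2 ^- q) ^+ 2.
    have -> : 4 ^- q = (2 ^- q) ^+ 2 :> R.
      by rewrite exprVn -!exprM mulnC exprM -[2 ^+ 2]natrX.
    by ring.
  apply: S2 => j; last exact: sqr_drift_le.
  rewrite drift_ge0 (le_trans (drift_le _ s0 st t1))//.
  by rewrite exprD invfM mulrA.
have le1 : \sum_(j < k) local_sigma (q + j)%N s t <=
    \sum_(j < k.+1) local_sigma (q + j)%N s t by rewrite big_ord_recr/= lerDl.
have le2 : local_sigma q s t <= \sum_(j < k.+1) local_sigma (q + j)%N s t.
  by rewrite big_ord_recl/= addn0 lerDl sumr_ge0.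
have X0 : 0 <= \sum_(j < k) local_sigma (q + j)%N s t by rewrite sumr_ge0.
have mu0 := mu_ge0; have := x0 q.
have r0 : 0 <= 32 * K ^+ 2 * 4 ^- q * 4 ^- N.
  by rewrite mulr_ge0 ?invr_ge0 ?exprn_ge0// mulr_ge0 ?invr_ge0 ?exprn_ge0//
    mulr_ge0// sqr_ge0.
move: r0 b2 le1 le2 X0 S2; move: (32 * _ * _ * _) (edist _ _) (local_sigma q s t).
move: (\sum_(j < k) drift _ _ _) (\sum_(j < k) _) (\sum_(j < k.+1) _).
move=> S X Y r b x r0 b2 XY xY X0 S2 x_ge0.
have N0 : 0 <= N%:R :> R by [].
have := sqr_ge0 (b - S); have := ler_wpM2l mu0 XY; have := ler_wpM2l N0 XY.
have := mulr_ge0 mu0 X0; have := mulr_ge0 N0 X0.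
by move: (N%:R : R) N0 S2 => M M0 S2; nra.
Qed.



Lemma norm_excess_le_closed i s t v : 0 <= s -> s <= t -> t <= 1 ->
  v \in G 0 -> lo v <= s -> t <= hi v -> (forall j, g j s = g j t) ->
  `|excess i s t| <= (14 + mu) * \sum_(j < i.+1) local_sigma j s t.
Proof.
move=> s0 st t1 v0 vs tv gst.
have sv : lo v <= s <= hi v by rewrite vs (le_trans st).
have tv' : lo v <= t <= hi v by rewrite tv (le_trans vs).
have vv : lo v <= hi v by rewrite (le_trans vs) ?(le_trans st).
have [E0 _] := excess_start s0 st t1 v0 v0 sv tv' vv.
have x0 j : 0 <= local_sigma j s t by exact: local_sigma_ge0.
have mu0 := mu_ge0.
have {}E0 : `|excess i s t| <= 12 * local_sigma 0 s t +
    (2 + mu) / 2 * \sum_(j < i) local_sigma j s t.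
  elim: i => [|i IH]; first by rewrite big_ord0 mulr0 addr0.
  rewrite -(subrKC (excess i s t) (excess i.+1 s t)) big_ord_recr/= mulrDr [leRHS]addrA.
  rewrite (le_trans (ler_normD _ _))// lerD//; exact: norm_excess_succ_closed.
rewrite (le_trans E0)// big_ord_recr/=.
have : local_sigma 0 s t <= \sum_(j < i.+1) local_sigma j s t.
  by rewrite big_ord_recl lerDl sumr_ge0.
have : 0 <= \sum_(j < i) local_sigma j s t by rewrite sumr_ge0.
by rewrite big_ord_recr/=; have := x0 i; nra.
Qed.

End CurveFamily.
Arguments curve_family {R n T} G lo hi K g A delta.
Arguments excess {R n} g A i s t.
Arguments local_sigma {R T} G lo hi delta m s t.
Arguments drift {R n} g m s t.

(** * Passing to the limit *)

Section Limits.
Context {R : realType}.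
Implicit Types (u y : nat -> R) (l : R).

Lemma cvg_geometric_bound u l (M : R) :
  (forall i, `|u i - l| <= M * 2 ^- i) -> u i @[i --> \oo] --> l.
Proof.
move=> uM; have half : `|2^-1 : R| < 1.
  by rewrite ger0_norm ?invr_ge0// invf_lt1 ?ltr1n.
apply/subr_cvg0; apply: norm_cvg0.
apply: (squeeze_cvgr _ (@cvg_cst _ (0 : R) _ _ _) (@cvg_geometric _ M _ half)).
by near=> i; rewrite normr_ge0/= exprVn uM.
Unshelve. all: by end_near. Qed.

Lemma cvgn_bounded_variation u y (Y : R) :
  (forall i, `|u i.+1 - u i| <= y i) -> (forall k, \sum_(j < k) y j <= Y) ->
  cvgn u.
Proof.
move=> uy yY; pose v k := \sum_(j < k) y j.
have y0 i : 0 <= y i by exact: le_trans (uy i).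
have cv : cvgn v.
  apply: nondecreasing_is_cvgn.
    by apply/nondecreasing_seqP => k; rewrite /v big_ord_recr/= lerDl.
  by exists Y => _ [k _ <-]; exact: yY.
have cuv : cvgn (u \+ v).
  apply: nondecreasing_is_cvgn.
    apply/nondecreasing_seqP => k; rewrite /= /v big_ord_recr/= -subr_ge0.
    by have := uy k; rewrite ler_norml => /andP[]; lra.
  exists (u 0%N + Y + Y) => _ [k _ <-] /=.
  apply: lerD; last exact: yY.
  suff : u k <= u 0%N + v k by move=> /le_trans; apply; rewrite lerD2l yY.
  elim: k => [|k IH]; first by rewrite /v big_ord0 addr0.
  rewrite /v big_ord_recr/= -/(v k).
  by have := uy k; rewrite ler_norml => /andP[]; lra.
have -> : u = (u \+ v) \- v by apply/funext => i /=; rewrite addrK.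
exact: is_cvgB.
Qed.

Lemma exists_small_tail y (Y e : R) : 0 < e -> (forall i, 0 <= y i) ->
  (forall k, \sum_(j < k) y j <= Y) ->
  exists m, forall i, \sum_(m <= j < i) y j <= e.
Proof.
move=> e0 y0 yY; pose E := range (fun k => \sum_(j < k) y j).
have supE : has_sup E.
  by split; [exists (\sum_(j < 0) y j); exists 0%N|exists Y => _ [k _ <-]; exact: yY].
have [_ [m _ <-] hm] := sup_adherent e0 supE.
exists m => i; have [mi|im] := leqP m i; last by rewrite big_geq ?ltW// ltnW.
have : \sum_(j < i) y j <= sup E by apply: sup_upper_bound => //; exists i.
rewrite -(big_mkord xpredT) (big_cat_nat (leq0n m) mi)/= big_mkord; lra.
Qed.

Lemma exists_exprV_le (b : nat) (a e : R) : (1 < b)%N -> 0 <= a -> 0 < e ->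
  exists N, a * b%:R ^- N <= e.
Proof.
move=> b1 a0 e0; have ae : 0 <= a / e by rewrite divr_ge0// ltW.
exists (Num.bound (a / e)); set N := Num.bound _.
have h1 : a / e < N%:R by apply: archi_boundP.
have h2 : (N%:R : R) <= b%:R ^+ N by rewrite -natrX ler_nat; apply/ltnW/ltn_expl.
have bN : 0 < b%:R ^+ N :> R by rewrite exprn_gt0// ltr0n ltnW.
rewrite ler_pdivrMr// mulrC -ler_pdivrMr// ltW//.
exact: lt_le_trans h2.
Qed.

Lemma sum_ord_shift (F : nat -> R) (q k : nat) :
  \sum_(j < k) F (q + j)%N = \sum_(q <= m < q + k) F m.
Proof.
rewrite -{2}[q]add0n big_addn addKn big_mkord.
by apply: eq_bigr => j _; rewrite addnC.
Qed.

(** Finitely many statements that hold eventually hold simultaneously. *)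
Lemma eventually_le_partition_sum (f F : nat -> R -> R -> R) a b d r :
  itv_partition a b r -> mesh_lt a r d ->
  (forall s t, a <= s -> s < t -> t <= b -> t - s < d ->
     \forall i \near \oo, f i s t <= F i s t) ->
  \forall i \near \oo, partition_sum (f i) a r <= partition_sum (F i) a r.
Proof.
elim: r a => [|x r IH] a par mr fF /=; first by near=> i.
have [/andP[ax _] _] := par; have xb := itv_partition_le (itv_partition_cons par).
have [xa mr'] := (mesh_lt_cons _ _ _ _).1 mr.
have h1 := fF a x (lexx _) ax xb xa.
have h2 : \forall i \near \oo, partition_sum (f i) x r <= partition_sum (F i) x r.
  apply: IH => //; first exact: itv_partition_cons par.
  by move=> s t xs; apply: fF; rewrite (le_trans _ xs)// ltW.
by near=> i; apply: lerD; near: i.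
Unshelve. all: by end_near. Qed.

Lemma cvg_partition_sum (f : nat -> R -> R -> R) (F : R -> R -> R) a b r :
  itv_partition a b r ->
  (forall s t, a <= s -> s < t -> t <= b -> f i s t @[i --> \oo] --> F s t) ->
  partition_sum (f i) a r @[i --> \oo] --> partition_sum F a r.
Proof.
elim: r a => [|x r IH] a par fF /=; first exact: cvg_cst.
have [/andP[ax _] _] := par; have xb := itv_partition_le (itv_partition_cons par).
apply: cvgD; first exact: fF.
apply: IH; first exact: itv_partition_cons par.
by move=> s t xs; apply: fF; rewrite (le_trans _ xs)// ltW.
Qed.

End Limits.

Lemma cvg_chord {R : realType} {n : nat} (g : nat -> R -> plane R n)
    (f : R -> plane R n) (M s t : R) :
  (forall i, edist (g i s) (f s) <= M * 2 ^- i) ->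
  (forall i, edist (g i t) (f t) <= M * 2 ^- i) ->
  chord (g i) s t @[i --> \oo] --> chord f s t.
Proof.
move=> gs gt; have M0 : 0 <= M.
  by have := le_trans (edist_ge0 _ _) (gs 0%N); rewrite expr0 invr1 mulr1.
apply: (@cvg_geometric_bound _ _ _ (M * (enorm (f t) + enorm (f s) + M))) => i.
have -> : chord (g i) s t - chord f s t = 2^-1 * (omega (g i s - f s) (g i t - f t)
    + omega (g i s - f s) (f t - 0) + omega (f s - 0) (g i t - f t)).
  by rewrite /chord !subr0 !(omegaDl, omegaDr, omegaNl, omegaNr); ring.
have h1 := norm_omega_sub_le (gs i) (gt i).
have h2 : `|omega (g i s - f s) (f t - 0)| <= M * 2 ^- i * enorm (f t).
  by apply: norm_omega_sub_le => //; rewrite /Defs.edist subr0.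
have h3 : `|omega (f s - 0) (g i t - f t)| <= enorm (f s) * (M * 2 ^- i).
  by apply: norm_omega_sub_le => //; rewrite /Defs.edist subr0.
have z1 : 2 ^- i <= 1 :> R by rewrite invf_le1 ?exprn_gt0// exprn_ege1// ler1n.
have z0 : 0 <= 2 ^- i :> R by rewrite invr_ge0 exprn_ge0.
rewrite normrM ger0_norm ?invr_ge0//.
rewrite (le_trans (ler_wpM2l _ (ler_normD _ _)))//.
rewrite (le_trans (ler_wpM2l _ (lerD (ler_normD _ _) (lexx _))))//.
move: h1 h2 h3 (enorm_ge0 (f s)) (enorm_ge0 (f t)).
move: (omega _ _) (omega _ _) (omega _ _) (enorm _) (enorm _) => a b c p q.
move: (2 ^- i) z0 z1 => z z0 z1 h1 h2 h3 p0 q0; have Mz := mulr_ge0 M0 z0.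
have z1' : 0 <= 1 - z by rewrite subr_ge0.
have := mulr_ge0 (mulr_ge0 M0 Mz) z1'; have := mulr_ge0 M0 Mz.
have := mulr_ge0 p0 Mz; have := mulr_ge0 q0 Mz.
move: h1 h2 h3; move: `|a| `|b| `|c| => {}a {}b {}c; nra.
Qed.

(** * The area of the limit curve *)

Section LimitArea.
Context {R : realType} {n : nat} {T : eqType}.
Context {mu : R} {G : nat -> seq T} {lo hi : T -> R} {ch : T -> seq T}.
Hypothesis tl : tiling mu G lo hi ch.
Context {K : R} {g : nat -> R -> plane R n} {A : nat -> R -> R} {delta : T -> R}.
Hypothesis fam : curve_family G lo hi K g A delta.

Definition level_sigma m : R := \sum_(v <- G m) delta v ^+ 2.

Context {sig : R}.
Hypothesis level_sigma_le : forall k, \sum_(m < k) level_sigma m <= sig.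
Implicit Types (s t x y : R) (v w : T).

Lemma level_sigma_ge0 m : 0 <= level_sigma m.
Proof. by apply: sumr_ge0 => v _; exact: sqr_ge0. Qed.

Lemma local_sigma_le m s t : local_sigma G lo hi delta m s t <= level_sigma m.
Proof.
rewrite /local_sigma big_mkcond; apply: ler_sum => v _.
by case: ifP => // _; exact: sqr_ge0.
Qed.

Lemma norm_excess01_le i N :
  `|excess g A i 0 1| <= (14 + mu + 8 * N%:R) * sig + 32 * K ^+ 2 * 4 ^- N.
Proof.
have [v v0 [lv hv]] := tile_root tl; have mu0 := mu_ge0 tl.
have := @norm_excess_le _ _ _ _ _ _ _ _ tl _ _ _ _ fam 0 i N 0 1 v v.
rewrite lv hv lexx ler01 expr0 invr1 mulr1 add0n.
move=> /(_ isT isT (lexx _) v0 v0 isT (lexx _) isT) /le_trans; apply.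
rewrite lerD2r ler_wpM2l ?addr_ge0 ?mulr_ge0//.
rewrite (le_trans _ (level_sigma_le i.+1))//.
by apply: ler_sum => j _; rewrite add0n local_sigma_le.
Qed.

Lemma norm_excess01_le_closed i : (forall j, g j 0 = g j 1) ->
  `|excess g A i 0 1| <= (14 + mu) * sig.
Proof.
move=> gc; have [v v0 [lv hv]] := tile_root tl; have mu0 := mu_ge0 tl.
have := @norm_excess_le_closed _ _ _ _ _ _ _ _ tl _ _ _ _ fam i 0 1 v.
rewrite lv hv => /(_ (lexx _) ler01 (lexx _) v0 (lexx _) (lexx _) gc) /le_trans; apply.
 rewrite ler_wpM2l ?addr_ge0//.
rewrite (le_trans _ (level_sigma_le i.+1))//.
by apply: ler_sum => j _; rewrite local_sigma_le.
Qed.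

Lemma cvgn_excess01 : cvgn (fun i => excess g A i 0 1).
Proof.
have mu0 := mu_ge0 tl.
have K0 : 0 <= K.
  have [v v0 _] := tile_root tl.
  have := le_trans (delta_ge0 tl fam v0) (family_delta fam v0).
  by rewrite expr0 invr1 mulr1.
pose e m := drift g m 0 1; have e0 m : 0 <= e m by exact: drift_ge0.
have e_le m : e m <= 2 * K * 2 ^- m by apply: (drift_le tl fam).
have geom k (M : R) : 0 <= M -> \sum_(j < k) M * 2 ^- j <= 2 * M.
  move=> M0; have := @ler_geometric_tail _ M 0 k (fun j => M * 2 ^- j).
  rewrite expr0 invr1 mulr1; apply=> j.
  by rewrite lexx andbT mulr_ge0// invr_ge0 exprn_ge0.
pose B := edist (g 0 1) (g 0 0) + 4 * K.
have B0 : 0 <= B by rewrite addr_ge0// mulr_ge0.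
have ends_le m : edist (g m 1) (g m 0) <= B.
  have := @edist_ends_le _ _ g 0 m 0 1; rewrite add0n => /le_trans; apply.
  rewrite lerD2l (@le_trans _ _ (\sum_(j < m) 2 * K * 2 ^- j))//.
    by apply: ler_sum => j _; exact: e_le.
  by rewrite (le_trans (geom _ _ _)) ?mulr_ge0// mulrA -natrM.
pose y m := (2 + mu) / 2 * level_sigma m + (B * K + 2 * K ^+ 2) * 2 ^- m.
apply: (@cvgn_bounded_variation _ _ y
  ((2 + mu) / 2 * sig + 2 * (B * K + 2 * K ^+ 2))) => [m|k].
  have := norm_excess_succ tl fam m (lexx 0) ler01 (lexx 1).
  move=> /le_trans; apply; rewrite lerD//.
    by rewrite ler_wpM2l ?local_sigma_le// mulr_ge0 ?addr_ge0.
  have dm := e_le m; have z1 : 2 ^- m <= 1 :> R.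
    by rewrite invf_le1 ?exprn_gt0// exprn_ege1// ler1n.
  have z0 : 0 <= 2 ^- m :> R by rewrite invr_ge0 exprn_ge0.
  have h1 : edist (g m 1) (g m 0) * e m <= B * (2 * K * 2 ^- m).
    by rewrite ler_pM.
  have h2 : e m ^+ 2 <= (2 * K * 2 ^- m) ^+ 2.
    by rewrite ler_pXn2r ?nnegrE ?(le_trans _ dm).
  have h3 : (2 * K * 2 ^- m) ^+ 2 <= 4 * K ^+ 2 * 2 ^- m.
    move: (2 ^- m : R) z0 z1 => z z0 z1.
    have z1' : 0 <= 1 - z by rewrite subr_ge0.
    have := mulr_ge0 (mulr_ge0 (mulr_ge0 K0 K0) z0) z1'; nra.
  rewrite -/(e m); lra.
rewrite big_split/= -mulr_sumr lerD//.
  by apply: ler_wpM2l; [rewrite mulr_ge0 ?addr_ge0|exact: level_sigma_le].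
by rewrite geom// addr_ge0 ?mulr_ge0 ?sqr_ge0.
Qed.

Context {gamma : R -> plane R n} {K' : R}.
Hypothesis gamma_close :
  forall i x, 0 <= x <= 1 -> edist (g i x) (gamma x) <= K' * 2 ^- i.
Context {h : R -> R -> R} {c H0 : R}.
Hypothesis h_tile : forall k w s t, w \in G k -> 0 <= s -> s <= lo w ->
  hi w <= t -> t <= 1 -> 4 ^- k <= c * h s t.
Hypothesis h_ge0 : forall s t, 0 <= s -> s < t -> t <= 1 -> 0 <= h s t.
Hypothesis h_sum : forall r, itv_partition 0 1 r ->
  partition_sum h 0 r = H0 - area_sum gamma 0 r.
Hypothesis tile_inside : forall s t, 0 <= s -> s < t -> t <= 1 ->
  exists k w, [/\ w \in G k, s <= lo w & hi w <= t].

Let coeff N : R := 14 + mu + 8 * N%:R.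

Lemma coeff_ge0 N : 0 <= coeff N.
Proof. by rewrite !addr_ge0 ?mulr_ge0 ?(mu_ge0 tl). Qed.

(** An interval shorter than [d] contains no interval of a generation before [M],
    so that its start generation is at least [M.-1]. *)
Lemma excess_near M d N s t : 0 <= s -> s < t -> t <= 1 -> t - s < d ->
  (forall m v, (m < M)%N -> v \in G m -> d <= hi v - lo v) ->
  \forall i \near \oo, `|excess g A i s t| <=
    coeff N * (\sum_(M.-1 <= m < i.+1) \sum_(w <- G m)
      delta w ^+ 2 * charge lo hi ch w s t)
    + 128 * K ^+ 2 * c * 4 ^- N * h s t.
Proof.
move=> s0 st t1 tsd wide.
have [q [k [/andP[qk kq] [w0 [w0k sw0 w0t]] [v [u [vq uq vs ut uv]]] charged]]] :=
  exists_start_generation tl s0 st t1 (tile_inside s0 st t1).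
have Mq : (M.-1 <= q)%N.
  have [kM|] := ltnP k M; last by case: (M) => //= M' /leq_trans/(_ kq).
  by have := wide k w0 kM w0k; lra.
near=> i.
have qi : (q <= i)%N by near: i; exact: nbhs_infty_ge.
rewrite -(subnKC qi) -addnS.
have := norm_excess_le tl fam (i - q) N s0 (ltW st) t1 vq uq vs ut uv.
move=> /le_trans; apply; apply: lerD.
  rewrite ler_wpM2l ?coeff_ge0//.
  rewrite (sum_ord_shift (fun m => local_sigma G lo hi delta m s t)).
  rewrite [leRHS](big_cat_nat Mq)/= ?leq_addr//.
  rewrite -[leLHS]add0r lerD//.
    apply: sumr_ge0 => m _; apply: sumr_ge0 => w _.
    by rewrite mulr_ge0 ?sqr_ge0 ?charge_ge0.
  rewrite big_nat [leRHS]big_nat; apply: ler_sum => m /andP[qm _].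
  rewrite /local_sigma big_mkcond big_seq [leRHS]big_seq; apply: ler_sum => w wm.
  case: ifP => [mw|_]; last by rewrite mulr_ge0 ?sqr_ge0 ?charge_ge0.
  by rewrite -[leLHS]mulr1 ler_wpM2l ?sqr_ge0// (charged m).
have hk := h_tile w0k s0 sw0 w0t t1.
have q4 : 4 ^- q <= 4 * 4 ^- k :> R.
  have : 4 ^- q.+1 <= 4 ^- k :> R.
    by rewrite lef_pV2 ?posrE ?exprn_gt0// ler_weXn2l// ler1n.
  by rewrite exprS invfM; lra.
have N0 : 0 <= 4 ^- N :> R by rewrite invr_ge0 exprn_ge0.
have : 4 ^- q <= 4 * (c * h s t) by lra.
move=> /(ler_wpM2r N0)/(ler_wpM2l (sqr_ge0 K)).
by move: (4 ^- q) (4 ^- N) (K ^+ 2) => a b e; nra.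
Unshelve. all: by end_near. Qed.


Lemma partition_sum_level_charge M i r : itv_partition 0 1 r ->
  partition_sum (fun s t => \sum_(M <= m < i) \sum_(w <- G m)
    delta w ^+ 2 * charge lo hi ch w s t) 0 r <=
  (4 + 2 * mu) * \sum_(M <= m < i) level_sigma m.
Proof.
move=> [pr _]; rewrite partition_sum_sum mulr_sumr; apply: ler_sum => m _.
rewrite partition_sum_sum mulr_sumr big_seq [leRHS]big_seq.
apply: ler_sum => w wm; rewrite partition_sumZ mulrC.
by rewrite ler_wpM2r ?sqr_ge0// (partition_sum_charge tl wm).
Qed.

Lemma cvgn_area : cvgn (fun i => A i 1 - A i 0).
Proof.
have -> : (fun i => A i 1 - A i 0) =
    (fun i => excess g A i 0 1) \+ (fun i => chord (g i) 0 1).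
  by apply/funext => i; rewrite /excess/= subrK.
apply: is_cvgD; first exact: cvgn_excess01.
apply/cvg_ex; exists (chord gamma 0 1).
by apply: (@cvg_chord _ _ _ _ K') => i; apply: gamma_close; rewrite ?lexx ?ler01.
Qed.

Let area := lim (A i 1 - A i 0 @[i --> \oo]).

Lemma norm_area_sub_le M d N tau r :
  (forall m v, (m < M)%N -> v \in G m -> d <= hi v - lo v) ->
  (forall i, \sum_(M.-1 <= m < i) level_sigma m <= tau) ->
  itv_partition 0 1 r -> mesh_lt 0 r d ->
  `|area - area_sum gamma 0 r| <= coeff N * ((4 + 2 * mu) * tau)
    + 128 * K ^+ 2 * c * 4 ^- N * partition_sum h 0 r.
Proof.
move=> wide tail r01 mr; have mu0 := mu_ge0 tl.
have lim_r : `|A i 1 - A i 0 - area_sum (g i) 0 r| @[i --> \oo] -->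
    `|area - area_sum gamma 0 r|.
  apply: cvg_norm; apply: cvgB; first exact: cvgn_area.
  rewrite area_sumE; under eq_fun do rewrite area_sumE.
  apply: (cvg_partition_sum r01) => s t s0 st t1.
  apply: (@cvg_chord _ _ _ _ K') => i; apply: gamma_close.
    by rewrite s0 (le_trans (ltW st)).
  by rewrite t1 (le_trans s0) ?ltW.
apply: (cvgr_to_le lim_r).
have : \forall i \near \oo, partition_sum (fun s t => `|excess g A i s t|) 0 r <=
    partition_sum (fun s t => coeff N * (\sum_(M.-1 <= m < i.+1) \sum_(w <- G m)
      delta w ^+ 2 * charge lo hi ch w s t)
    + 128 * K ^+ 2 * c * 4 ^- N * h s t) 0 r.
  apply: (eventually_le_partition_sum r01 mr) => s t s0 st t1 tsd.
  exact: excess_near tsd wide.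
apply: filterS => i bound.
have -> : A i 1 - A i 0 - area_sum (g i) 0 r =
    partition_sum (excess g A i) 0 r.
  have [_ /eqP lr] := r01; rewrite -[in A i 1]lr -partition_sum_telescope area_sumE.
  by rewrite -mulN1r -partition_sumZ -partition_sumD; congr partition_sum;
    apply/funext => s; apply/funext => t; rewrite mulN1r.
rewrite (le_trans (norm_partition_sum _ _ _))// (le_trans bound)//.
rewrite partition_sumD !partition_sumZ lerD2r ler_wpM2l ?coeff_ge0//.
rewrite (le_trans (partition_sum_level_charge _ _ r01))//.
by rewrite ler_wpM2l ?addr_ge0 ?mulr_ge0.
Qed.

(** By [h_sum], the error of a sum of chords controls the sum of [h] over the
    partition. That sum enters the estimate of the error with a coefficient as
    small as desired, so it is bounded independently of the partition; then N is
    chosen large, and the generations that matter are made late by the mesh. *)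
Theorem is_symplectic_area_limit : is_symplectic_area 0 1 gamma area.
Proof.
have mu0 := mu_ge0 tl.
have c0 : 0 <= c.
  have h01 := h_ge0 (lexx 0) ltr01 (lexx 1).
  have [v v0 [lv hv]] := tile_root tl.
  have := h_tile (s := 0) (t := 1) v0; rewrite lv hv expr0 invr1.
  move=> /(_ (lexx _) (lexx _) (lexx _) (lexx _)) ch1.
  by rewrite leNgt; apply/negP => c_lt0; nra.
pose a := 128 * K ^+ 2 * c.
have a0 : 0 <= a by rewrite mulr_ge0// mulr_ge0// sqr_ge0.
have e20 : 0 < 2^-1 :> R by rewrite invr_gt0.
have [N0 aN0] := exists_exprV_le (isT : 1 < 4)%N a0 e20.
pose B := coeff N0 * ((4 + 2 * mu) * sig).
pose H := 2 * (`|H0| + `|area| + B).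
have sum_h_le d r : itv_partition 0 1 r -> mesh_lt 0 r d ->
    partition_sum h 0 r <= H.
  move=> r01 mr.
  have : `|area - area_sum gamma 0 r| <= B + a * 4 ^- N0 * partition_sum h 0 r.
    apply: (norm_area_sub_le (M := 0) N0 _ _ r01 mr) => // i.
    by rewrite big_mkord level_sigma_le.
  have sum_h := h_sum r01.
  have h0 : 0 <= partition_sum h 0 r.
    by apply: (partition_sum_ge0 r01) => s t; exact: h_ge0.
  have aH := ler_wpM2r h0 aN0.
  rewrite ler_norml => /andP[hl hr].
  have := ler_norm H0; have := ler_norm (- area); rewrite normrN /H; lra.
move=> e e0.
have aH0 : 0 <= a * `|H| by rewrite mulr_ge0.
have e40 : 0 < e / 4 by rewrite divr_gt0.
have [N aN] := exists_exprV_le (isT : 1 < 4)%N aH0 e40.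
have q0 : 0 < coeff N * (4 + 2 * mu) + 1.
  by rewrite ltr_wpDl// mulr_ge0 ?coeff_ge0// addr_ge0 ?mulr_ge0.
have tau0 : 0 < e / 4 / (coeff N * (4 + 2 * mu) + 1) by rewrite divr_gt0.
have [m0 tail] := exists_small_tail tau0 level_sigma_ge0 level_sigma_le.
have [d d0 wide] := tile_width tl m0.
exists d => // r r01 mr.
have := norm_area_sub_le (M := m0.+1) N wide tail r01 mr.
move=> /le_lt_trans; apply.
have := sum_h_le _ _ r01 mr; rewrite -/a => hH.
have h1 : a * 4 ^- N * partition_sum h 0 r <= e / 4.
  have aN0' : 0 <= a * 4 ^- N by rewrite mulr_ge0// invr_ge0 exprn_ge0.
  rewrite (le_trans _ aN)// [leRHS]mulrAC ler_wpM2l//.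
  by rewrite (le_trans hH)// ler_norm.
have h2 : coeff N * ((4 + 2 * mu) * (e / 4 / (coeff N * (4 + 2 * mu) + 1))) <= e / 4.
  move: tau0; set tau := e / 4 / _ => tau0.
  have <- : tau * (coeff N * (4 + 2 * mu) + 1) = e / 4 by rewrite divfK// gt_eqF.
  by rewrite mulrA [leRHS]mulrC ler_wpM2r ?lerDl// ltW.
lra.
Qed.

End LimitArea.
Arguments level_sigma {R T} G delta m.

(** * Vertical curves *)

Section Diameter.
Context {R : realType} {T : Type}.
Implicit Types (d : T -> T -> R) (A B : set T).

Let distances d A : set R := [set r | exists p q, [/\ A p, A q & r = d p q]].

Lemma le_diam d A M p q : (forall p q, A p -> A q -> d p q <= M) ->
  A p -> A q -> d p q <= diam d A.
Proof.
move=> dM Ap Aq; apply: sup_upper_bound; last by exists p, q.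
split; first by exists (d p q), p, q.
by exists M => _ [p' [q' [Ap' Aq' ->]]]; exact: dM.
Qed.

Lemma diam_le d A M : A !=set0 -> (forall p q, A p -> A q -> d p q <= M) ->
  diam d A <= M.
Proof.
move=> [p Ap] dM; apply: ge_sup; first by exists (d p p), p, p.
by move=> _ [p' [q' [Ap' Aq' ->]]]; exact: dM.
Qed.

(** The supremum of an unbounded set is 0 by convention, so a set of positive
    diameter is bounded. *)
Lemma le_diam_gt0 d A p q : 0 < diam d A -> A p -> A q -> d p q <= diam d A.
Proof.
move=> d0 Ap Aq; apply: sup_upper_bound; last by exists p, q.
by apply: contrapT => /sup_out e; move: d0; rewrite /diam e ltxx.
Qed.

End Diameter.

Section Koranyi.
Context {R : realType} {n : nat}.
Implicit Types p q : heisenberg R n.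

Lemma hproj_hinv p : hproj (hinv p) = - hproj p.
Proof. by rewrite /hproj /hinv linearN. Qed.

Lemma hz_hmul p q : hz (hmul p q) = hz p + hz q + 2^-1 * omega (hproj p) (hproj q).
Proof.
by rewrite /hz /hmul /hZ !linearD linearZ /= row_mxKr !mxE eqxx mulr1.
Qed.

(** Along a vertical curve, the vertical displacement from [p] to [q] is
    comparable to the square of their distance. *)
Definition height p q : R := hz (hmul (hinv p) q).

Lemma heightE p q : height p q = hz q - hz p - 2^-1 * omega (hproj p) (hproj q).
Proof.
rewrite /height hz_hmul hproj_hinv omegaNl mulrN.
by rewrite {1}/hz /hinv linearN /= mxE (addrC (- _)).
Qed.

Lemma heightxx p : height p p = 0.
Proof. by rewrite heightE omegaxx mulr0 !subrr. Qed.

Lemma heightC p q : height p q = - height q p.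
Proof. by rewrite !heightE omegaC; ring. Qed.

Lemma hproj_hmulV p q : hproj (hmul (hinv p) q) = hproj q - hproj p.
Proof. by rewrite hproj_hmul hproj_hinv addrC. Qed.

Lemma hdist_ge0 p q : 0 <= hdist p q.
Proof. exact: powR_ge0. Qed.

Lemma hdist_expr4 p q :
  hdist p q ^+ 4 = edist (hproj p) (hproj q) ^+ 4 + 16 * height p q ^+ 2.
Proof.
rewrite /hdist /hnorm hproj_hmulV -[enorm _]/(edist _ _) edistC -/(height p q).
rewrite -powR_mulrn ?powR_ge0// -powRrM mulVf// powRr1//.
by apply: addr_ge0; [exact: exprn_ge0|rewrite mulr_ge0 ?sqr_ge0].
Qed.

Lemma edist_hproj_le p q : edist (hproj p) (hproj q) <= hdist p q.
Proof.
rewrite -(@ler_pXn2r _ 4) ?nnegrE ?hdist_ge0// hdist_expr4 lerDl.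
by rewrite mulr_ge0 ?sqr_ge0.
Qed.

Lemma vertical_curve_height (E : set (heisenberg R n)) p q :
  vertical_curve 2 E -> E p -> E q ->
  2 * edist (hproj p) (hproj q) ^+ 2 <= `|height p q|.
Proof.
move=> vE Ep Eq; have [c /= vc <-] := vE p Ep q Eq; rewrite /height.
rewrite hmulA hmulVp hmul0p hproj_hmul edistC /edist.
by have := vc; rewrite /vcone/= addrAC subrr add0r.
Qed.

Lemma sqr_hdist_le (E : set (heisenberg R n)) p q :
  vertical_curve 2 E -> E p -> E q -> hdist p q ^+ 2 <= 5 * `|height p q|.
Proof.
move=> vE Ep Eq; have hpq := vertical_curve_height vE Ep Eq.
have h0 := normr_ge0 (height p q).
(* By verticality d^4 <= h^2 / 4 + 16 h^2 <= 25 h^2. *)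
rewrite -(@ler_pXn2r _ 2) ?nnegrE ?exprn_ge0 ?hdist_ge0 ?mulr_ge0//.
rewrite -exprM hdist_expr4 exprMn.
rewrite -[X in 16 * X](real_normK (num_real _)) (_ : 4 = 2 * 2)%N// exprM.
move: h0 (sqr_ge0 (edist (hproj p) (hproj q))) hpq.
by move: `|_| (edist _ _ ^+ 2) => a b a0 b0 ba; nra.
Qed.

End Koranyi.

Section VerticalCurve.
Context {R : realType} {n : nat} {K : set (heisenberg R n)}.
Context {zeta : R -> heisenberg R n}.
Hypothesis K_vertical : vertical_curve 2 K.
Hypothesis zeta_incr : increasing_parameterization K zeta.
Implicit Types (r s t x y : R).

Local Notation gamma x := (hproj (zeta x)).
Local Notation h s t := (height (zeta s) (zeta t)).

Lemma param_mem x : 0 <= x <= 1 -> K (zeta x).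
Proof.
by case: zeta_incr => -[_ [zK _ _] _] _ x01; apply: zK; rewrite /= in_itv.
Qed.

Lemma param_inj x y : 0 <= x <= 1 -> 0 <= y <= 1 -> zeta x = zeta y -> x = y.
Proof.
by case: zeta_incr => -[_ [_ zi _] _] _ x01 y01; apply: zi; rewrite inE/= in_itv.
Qed.

Lemma height_gt0 s t : 0 <= s -> s < t -> t <= 1 -> 0 < h s t.
Proof.
case: zeta_incr => _ zm s0 st t1; apply: zm => //; rewrite in_itv/=.
  by rewrite s0 (le_trans (ltW st)).
by rewrite t1 (le_trans s0) ?ltW.
Qed.

Lemma height_ge0 s t : 0 <= s -> s <= t -> t <= 1 -> 0 <= h s t.
Proof.
move=> s0; rewrite le_eqVlt => /predU1P[<-|st] t1; first by rewrite heightxx.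
exact/ltW/height_gt0.
Qed.

Lemma sqr_edist_height s t : 0 <= s -> s <= t -> t <= 1 ->
  2 * edist (gamma s) (gamma t) ^+ 2 <= h s t.
Proof.
move=> s0 st t1; rewrite -(ger0_norm (height_ge0 s0 st t1)).
by apply: (vertical_curve_height K_vertical); apply: param_mem;
  rewrite ?s0 ?t1 ?(le_trans s0)// (le_trans st).
Qed.

(** The height is additive up to the area of a triangle, which verticality makes
    small compared to the heights of its sides. *)
Lemma height_superadditive r s t : 0 <= r -> r <= s -> s <= t -> t <= 1 ->
  7 / 8 * (h r s + h s t) <= h r t.
Proof.
move=> r0 rs st t1.
have h1 := sqr_edist_height r0 rs (le_trans st t1).
have h2 := sqr_edist_height (le_trans r0 rs) st t1.
have -> : h r t = h r s + h s t + 2^-1 * omega (gamma s - gamma r) (gamma t - gamma s).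
  rewrite !heightE !(omegaDl, omegaDr, omegaNl, omegaNr) omegaxx.
  by ring.
have := norm_omega_le (gamma s - gamma r) (gamma t - gamma s).
rewrite -/(edist (gamma s) (gamma r)) -/(edist (gamma t) (gamma s)).
rewrite (edistC (gamma s)) (edistC (gamma t)) ler_norml => /andP[w _].
have := sqr_ge0 (edist (gamma r) (gamma s) - edist (gamma s) (gamma t)).
by move: (edist _ _) (edist _ _) h1 h2 w => a b h1 h2 w; nra.
Qed.

(** Two applications of superadditivity, and (8 / 7)^2 <= 7 / 5. *)
Lemma height_le s t x y : 0 <= s -> s <= x -> x <= y -> y <= t -> t <= 1 ->
  h x y <= 7 / 5 * h s t.
Proof.
move=> s0 sx xy yt t1; have x0 := le_trans s0 sx; have y1 := le_trans yt t1.
have h1 := height_superadditive s0 sx (le_trans xy yt) t1.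
have h2 := height_superadditive x0 xy yt t1.
have h3 := height_ge0 s0 sx (le_trans xy y1).
have h4 := height_ge0 (le_trans x0 xy) yt t1.
by have h5 := height_ge0 x0 xy y1; lra.
Qed.

Lemma partition_sum_height (r : seq R) : itv_partition 0 1 r ->
  partition_sum (fun s t => h s t) 0 r =
  hz (zeta 1) - hz (zeta 0) - area_sum (fun x => gamma x) 0 r.
Proof.
move=> [_ /eqP lr]; rewrite area_sumE -{1}lr -(partition_sum_telescope (hz \o zeta)).
rewrite -mulN1r -partition_sumZ -partition_sumD; congr partition_sum.
by apply/funext => s; apply/funext => t; rewrite heightE mulN1r.
Qed.

(** ** Subarcs *)

Lemma param_itv_image a b : 0 <= a -> b <= 1 ->
  param_itv zeta (zeta @` `[a, b]) = `[a, b]%classic.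
Proof.
move=> a0 b1; apply/seteqP; split=> [x [/= x01 [y yab yx]]|x /= xab].
  rewrite -(param_inj _ x01 yx)//.
  move: yab; rewrite /= in_itv/= => /andP[ay yb].
  by rewrite (le_trans a0)// (le_trans yb).
split; last by exists x.
move: xab; rewrite /= !in_itv/= => /andP[ax xb].
by rewrite (le_trans a0)// (le_trans xb).
Qed.

Lemma is_subarcP (A : set (heisenberg R n)) : is_subarc zeta A ->
  [/\ 0 <= param_left zeta A, param_left zeta A < param_right zeta A,
      param_right zeta A <= 1 &
      param_itv zeta A = `[param_left zeta A, param_right zeta A]%classic].
Proof.
move=> [a [b [a0 ab b1 ->]]].
rewrite /param_left /param_right !param_itv_image//.
by rewrite inf_itvcc ?sup_itvcc// ltW.
Qed.

Lemma param_itvP (A : set (heisenberg R n)) x : is_subarc zeta A ->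
  (param_left zeta A <= x <= param_right zeta A) <-> (0 <= x <= 1) /\ A (zeta x).
Proof.
move=> /is_subarcP[_ _ _ e].
have -> : (param_left zeta A <= x <= param_right zeta A) <-> param_itv zeta A x.
  by rewrite e /= in_itv.
by rewrite /param_itv /= in_itv/=.
Qed.

End VerticalCurve.

(** * The intervals of a patchwork *)

Section Patchwork.
Context {R : realType} {n : nat} {K : set (heisenberg R n)}.
Context {zeta : R -> heisenberg R n} {T : choiceType} {t : rooted_tree T}.
Context {I : T -> set (heisenberg R n)} {mu : R}.
Hypothesis K_vertical : vertical_curve 2 K.
Hypothesis K_gt0 : 0 < diam hdist K.
Hypothesis zeta_incr : increasing_parameterization K zeta.
Hypothesis patch : is_patchwork zeta mu K t I.
Implicit Types (x y : R) (v w : T).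

Local Notation gamma x := (hproj (zeta x)).
Local Notation D := (diam hdist K).
Definition arc_left v := param_left zeta (I v).
Definition arc_right v := param_right zeta (I v).
Local Notation lo := arc_left.
Local Notation hi := arc_right.
Local Notation G := (ordered_generation zeta t I).

Definition children_seq v : seq T := fset_set (children t v).
Local Notation ch := children_seq.

Lemma patch_subarc v : is_subarc zeta (I v).
Proof. by case: patch => _ [+ _] _ _; exact. Qed.

Lemma finite_children v : finite_set (children t v).
Proof. by case: patch => + _ _ _ => /(_ v)[]. Qed.

Lemma mem_children_seq v w : w \in ch v <-> children t v w.
Proof.
by rewrite /children_seq in_fset_set ?inE//; exact: finite_children.
Qed.

Lemma mem_patch v x : lo v <= x <= hi v <-> 0 <= x <= 1 /\ I v (zeta x).
Proof. exact: (param_itvP zeta_incr _ (patch_subarc v)). Qed.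

Lemma mem_patch_unit v x : lo v <= x <= hi v -> 0 <= x <= 1.
Proof. by move=> /mem_patch[]. Qed.

Lemma patch_lt v : [/\ 0 <= lo v, lo v < hi v & hi v <= 1].
Proof. by have [] := is_subarcP zeta_incr (patch_subarc v). Qed.

Lemma finite_generation i : finite_set (generation t i).
Proof.
elim: i => [|i IH] /=; first exact: finite_set1.
by apply: bigcup_finite => // v _; exact: finite_children.
Qed.

Lemma mem_ordered_generation i v : v \in G i <-> generation t i v.
Proof.
rewrite /ordered_generation mem_sort in_fset_set ?inE//.
exact: finite_generation.
Qed.

Lemma children_sub v w : children t v w -> lo v <= lo w /\ hi w <= hi v.
Proof.
move=> vw; have [w0 /ltW ww w1] := patch_lt w.
have sub x : lo w <= x <= hi w -> lo v <= x <= hi v.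
  move=> /mem_patch[x01 Iw]; apply/mem_patch; split => //.
  by case: patch => _ _ /(_ v)[<- _] _; exists w.
have /andP[+ _] : lo v <= lo w <= hi v by apply: sub; rewrite lexx.
by have /andP[_ +] : lo v <= hi w <= hi v by apply: sub; rewrite lexx andbT.
Qed.

(** Two closed intervals that overlap have an overlap with interior points, and
    those are no endpoints. *)
Lemma children_disjoint v w w' : children t v w -> children t v w' -> w != w' ->
  hi w <= lo w' \/ hi w' <= lo w.
Proof.
move=> vw vw' ww'; have [//|h1] := leP (hi w) (lo w'); first by left.
have [//|h2] := leP (hi w') (lo w); first by right.
have [w0 ww w1] := patch_lt w; have [w0' ww2 w1'] := patch_lt w'.
pose a := Num.max (lo w) (lo w'); pose b := Num.min (hi w) (hi w').
have ab : a < b by rewrite lt_min !gt_max ww h1 h2 ww2.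
have aw : lo w <= a by rewrite le_max lexx.
have aw' : lo w' <= a by rewrite le_max lexx orbT.
have bw : b <= hi w by rewrite ge_min lexx.
have bw' : b <= hi w' by rewrite ge_min lexx orbT.
have [x01 Iw] : 0 <= (a + b) / 2 <= 1 /\ I w (zeta ((a + b) / 2)).
  by apply/mem_patch; apply/andP; split; lra.
have [_ Iw'] : 0 <= (a + b) / 2 <= 1 /\ I w' (zeta ((a + b) / 2)).
  by apply/mem_patch; apply/andP; split; lra.
have lw : 0 <= lo w <= 1 by apply/andP; split; lra.
have hw : 0 <= hi w <= 1 by apply/andP; split; lra.
case: patch => _ _ /(_ v)[_ /(_ w w' vw vw' ww')] /(_ (zeta ((a + b) / 2))).
move=> /(_ (conj Iw Iw'))[[]] e _ _.
  have : (a + b) / 2 = lo w by exact: (param_inj zeta_incr x01 lw e).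
  lra.
have : (a + b) / 2 = hi w by exact: (param_inj zeta_incr x01 hw e).
lra.
Qed.

Lemma generation_disjoint i v w : generation t i v -> generation t i w -> v != w ->
  hi v <= lo w \/ hi w <= lo v.
Proof.
elim: i v w => [|i IH] v w /=; first by move=> -> ->; rewrite eqxx.
move=> [p ip pv] [q iq qw] vw; have [pq|pq] := eqVneq p q.
  by move: qw; rewrite -pq => pw; exact: children_disjoint pv pw vw.
have [pv1 pv2] := children_sub pv; have [qw1 qw2] := children_sub qw.
by have [h|h] := IH _ _ ip iq pq; [left|right]; lra.
Qed.

Lemma root_itv : lo (tree_root t) = 0 /\ hi (tree_root t) = 1.
Proof.
rewrite /arc_left /arc_right; have -> : I (tree_root t) = K by case: patch => _ [].
have -> : K = zeta @` `[0, 1].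
  apply/seteqP; split => [p Kp|_ [x x01 <-]].
    by case: zeta_incr => -[_ [_ _ zs] _] _; exact: zs.
  by apply: (param_mem zeta_incr); move: x01; rewrite /= in_itv.
rewrite /param_left /param_right (param_itv_image zeta_incr)//.
by rewrite inf_itvcc ?sup_itvcc.
Qed.

Lemma generation_cover i x : 0 <= x <= 1 ->
  exists2 v, generation t i v & lo v <= x <= hi v.
Proof.
elim: i => [|i IH] x01.
  by exists (tree_root t) => //; have [-> ->] := root_itv.
have [v iv xv] := IH x01; have [_ Iv] := (mem_patch _ _).1 xv.
have : (\bigcup_(w in children t v) I w) (zeta x).
  by case: patch => _ _ /(_ v)[-> _].
by move=> [w vw Iw]; exists w; [exists v|apply/mem_patch].
Qed.

Lemma patchwork_tiling : tiling mu G lo hi ch.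
Proof.
split => [i|i v _|i v w|i x x01||i w|i v _].
- by rewrite sort_uniq; exact: fset_uniq.
- exact: patch_lt.
- by move=> /mem_ordered_generation iv /mem_ordered_generation; exact: generation_disjoint.
- have [v iv xv] := generation_cover i x01.
  by exists v => //; exact/mem_ordered_generation.
- by exists (tree_root t); [exact/mem_ordered_generation|exact: root_itv].
- move=> /mem_ordered_generation[v iv vw]; have [h1 h2] := children_sub vw.
  by exists v; [exact/mem_ordered_generation|split => //; exact/mem_children_seq].
- by case: patch => /(_ v)[].
Qed.

Let tl := patchwork_tiling.

(** ** Oscillation of the projected curve *)

Lemma hdist_patch_le i v x y : v \in G i -> lo v <= x <= hi v -> lo v <= y <= hi v ->
  hdist (zeta x) (zeta y) <= mu * 2 ^- i * D.
Proof.
move=> /mem_ordered_generation iv xv yv.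
case: patch => _ _ _ /(_ i v iv)/andP[_]; apply: le_trans.
have subK p : I v p -> K p.
  have [a [b [a0 ab b1 ->]]] := patch_subarc v.
  move=> [z /=]; rewrite in_itv/= => /andP[az zb] <-.
  by apply: (param_mem zeta_incr); rewrite (le_trans a0)// (le_trans zb).
apply: (@le_diam _ _ _ _ D); last 2 first.
- by have [] := (mem_patch _ _).1 xv.
- by have [] := (mem_patch _ _).1 yv.
- by move=> p q /subK Kp /subK Kq; exact: le_diam_gt0.
Qed.

Lemma edist_patch_le i v x y : v \in G i -> lo v <= x <= hi v -> lo v <= y <= hi v ->
  edist (gamma x) (gamma y) <= mu * 2 ^- i * D.
Proof.
by move=> vi xv yv; apply: le_trans (edist_hproj_le _ _) (hdist_patch_le vi xv yv).
Qed.

(** The height over an interval dominates that over any smaller one, hence the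
    squared diameter of any subarc that it contains. *)
Lemma expr4_height_ge k w x y : w \in G k -> 0 <= x -> x <= lo w -> hi w <= y ->
  y <= 1 -> 0 < mu -> 4 ^- k <= 7 * mu ^+ 2 / D ^+ 2 * height (zeta x) (zeta y).
Proof.
move=> wk x0 xw wy y1 mu0; have [_ ww _] := patch_lt w.
have xy : x <= y by lra.
have h0 := height_ge0 zeta_incr x0 xy y1.
pose M := 7 * height (zeta x) (zeta y); have M0 : 0 <= M by rewrite mulr_ge0.
have diam2 : diam hdist (I w) <= Num.sqrt M.
  apply: diam_le => [|p q Ip Iq].
    by exists (zeta (lo w)); have /mem_patch[] : lo w <= lo w <= hi w by rewrite lexx ltW.
  have [a [b [a0 ab b1 Iab]]] := patch_subarc w.
  have param p' : I w p' -> exists2 z, lo w <= z <= hi w & p' = zeta z.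
    rewrite Iab => -[z zab zp]; exists z => //; apply/mem_patch; split.
      move: zab; rewrite /= in_itv/= => /andP[az zb].
      by rewrite (le_trans a0)// (le_trans zb).
    by rewrite Iab; exists z.
  have le u z : lo w <= u -> u <= z -> z <= hi w ->
      5 * `|height (zeta u) (zeta z)| <= M.
    move=> wu uz zw; have u0 : 0 <= u by lra.
    have z1 : z <= 1 by lra.
    rewrite ger0_norm ?(height_ge0 zeta_incr)//.
    have xu : x <= u by lra.
    have zy : z <= y by lra.
    by have := height_le K_vertical zeta_incr x0 xu uz zy y1; rewrite /M; lra.
  rewrite -(@ler_pXn2r _ 2) ?nnegrE ?hdist_ge0 ?sqrtr_ge0// sqr_sqrtr//.
  have sub p' : I w p' -> K p'.
    move=> /param[z zw ->]; apply: (param_mem zeta_incr); exact: mem_patch_unit zw.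
  rewrite (le_trans (sqr_hdist_le K_vertical (sub _ Ip) (sub _ Iq)))//.
  have [u /andP[wu uw] ->] := param _ Ip; have [v /andP[wv vw] ->] := param _ Iq.
  have [uv|/ltW vu] := leP u v; first exact: le.
  by rewrite heightC normrN; exact: le.
have gk : mu^-1 * 2 ^- k * D <= diam hdist (I w).
  by case: patch => _ _ _ /(_ k w); rewrite -mem_ordered_generation => /(_ wk)/andP[].
have gk0 : 0 <= mu^-1 * 2 ^- k * D.
  by rewrite !mulr_ge0 ?invr_ge0 ?exprn_ge0// ltW.
have : (mu^-1 * 2 ^- k * D) ^+ 2 <= M.
  rewrite -[leRHS](sqr_sqrtr M0) ler_pXn2r ?nnegrE ?sqrtr_ge0//.
  exact: le_trans gk diam2.
have -> : (mu^-1 * 2 ^- k * D) ^+ 2 = 4 ^- k * D ^+ 2 / mu ^+ 2.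
  have -> : 4 ^- k = (2 ^- k) ^+ 2 :> R.
    by rewrite exprVn -!exprM mulnC exprM -[2 ^+ 2]natrX.
  by rewrite !exprMn (exprVn mu) -mulrA mulrC.
rewrite ler_pdivrMr ?exprn_gt0// -ler_pdivlMr ?exprn_gt0// /M => /le_trans; apply.
by rewrite le_eqVlt; apply/orP; left; apply/eqP; ring.
Qed.

(** The interval that contains the midpoint of [[x, y]] cannot reach x or y once
    its arc is smaller than the distances to the endpoints. *)
Lemma exists_tile_inside x y : 0 <= x -> x < y -> y <= 1 ->
  exists k w, [/\ w \in G k, x <= lo w & hi w <= y].
Proof.
move=> x0 xy y1; pose z := (x + y) / 2.
have xz : x < z by rewrite /z; lra.
have zy : z < y by rewrite /z; lra.
have z01 : 0 <= z <= 1 by apply/andP; split; lra.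
have hdist_gt0 a b : 0 <= a -> a < b -> b <= 1 -> 0 < hdist (zeta a) (zeta b).
  move=> a0 ab b1; rewrite lt_def hdist_ge0 andbT; apply/eqP => h0.
  have := hdist_expr4 (zeta a) (zeta b); rewrite h0 expr0n/=.
  have := height_gt0 zeta_incr a0 ab b1 => h1.
  have : 0 < 16 * height (zeta a) (zeta b) ^+ 2 by rewrite mulr_gt0// exprn_gt0.
  have : 0 <= edist (gamma a) (gamma b) ^+ 4 by rewrite exprn_ge0.
  lra.
have d1 : 0 < hdist (zeta x) (zeta z) by apply: hdist_gt0 => //; lra.
have d2 : 0 < hdist (zeta z) (zeta y) by apply: hdist_gt0 => //; lra.
have muD : 0 <= mu * D.
  by rewrite mulr_ge0 ?(mu_ge0 tl)// ltW.
have [d d0 [dx dy]] : exists2 d, 0 < d &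
    d <= hdist (zeta x) (zeta z) /\ d <= hdist (zeta z) (zeta y).
  move: (hdist _ _) (hdist _ _) d1 d2 => a b a0 b0.
  exists (Num.min a b); first by rewrite lt_min a0 b0.
  by rewrite !ge_min !lexx orbT.
have [k hk] : exists k, mu * 2 ^- k * D < d.
  have d20 : 0 < d / 2 by rewrite divr_gt0.
  have [k hk] := exists_exprV_le (isT : 1 < 2)%N muD d20.
  by exists k; rewrite mulrAC (le_lt_trans hk)// ltr_pdivrMr// ltr_pMr// ltr1n.
have [w wk /andP[wz zw]] := tile_cover tl k z01.
have win : lo w <= z <= hi w by rewrite wz.
exists k, w; split=> //; rewrite leNgt; apply/negP => h.
  have xw : lo w <= x <= hi w by rewrite (ltW h)/= (le_trans (ltW xz) zw).
  by have := le_lt_trans (le_trans dx (hdist_patch_le wk xw win)) hk; rewrite ltxx.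
have yw : lo w <= y <= hi w by rewrite (ltW h) andbT (le_trans wz (ltW zy)).
by have := le_lt_trans (le_trans dy (hdist_patch_le wk win yw)) hk; rewrite ltxx.
Qed.

End Patchwork.
Arguments arc_left {R n} zeta {T} I v.
Arguments arc_right {R n} zeta {T} I v.
Arguments children_seq {T} t v.

(** * The approximating curves of a patchwork *)

(** Midpoints of the intervals of one generation, listed by left endpoints, are
    strictly increasing because the intervals do not overlap. *)
Lemma path_tile_mid {R : realType} {T : eqType} {mu : R} {G : nat -> seq T}
    {lo hi : T -> R} {ch : T -> seq T} (tl : tiling mu G lo hi ch)
    (i : nat) (a : R) (r : seq T) : a < 1 ->
  {subset r <= G i} -> uniq r -> sorted (fun v w => lo v <= lo w) r ->
  {in r, forall w, a < tile_mid lo hi w} ->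
  path <%R a (rcons [seq tile_mid lo hi w | w <- r] 1).
Proof.
elim: r a => [|w r IH] a a1 rG /=; first by rewrite a1.
move=> /andP[wr ur] rs mid; rewrite mid ?mem_head//=.
have wi : w \in G i by rewrite rG ?mem_head.
have [_ ww w1] := tile_lt tl wi; have /andP[m1 m2] := tile_mid_in tl wi.
have tr : transitive (fun v u => lo v <= lo u) by move=> x y z; exact: le_trans.
apply: IH => //; [by rewrite (lt_le_trans m2)| | |].
- by move=> u ur'; apply: rG; rewrite inE ur' orbT.
- exact: path_sorted rs.
- move=> u ur'; have ui : u \in G i by rewrite rG// inE ur' orbT.
  have [_ uu _] := tile_lt tl ui; have /andP[m3 m4] := tile_mid_in tl ui.
  have wu : lo w <= lo u by have /allP := order_path_min tr rs; apply.
  have : w != u by apply: contraNneq wr => ->.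
  by case/(tile_disjoint tl wi ui) => h; lra.
Qed.

Section Approximation.
Context {R : realType} {n : nat} {K : set (heisenberg R n)}.
Context {zeta : R -> heisenberg R n} {T : choiceType} {t : rooted_tree T}.
Context {I : T -> set (heisenberg R n)} {mu C : R} {Lambda : T -> plane R n}.
Hypothesis mu0 : 0 < mu.
Hypothesis C0 : 0 < C.
Hypothesis K_gt0 : 0 < diam hdist K.
Hypothesis zeta_incr : increasing_parameterization K zeta.
Hypothesis patch : is_patchwork zeta mu K t I.
Hypothesis approx : approximating_points zeta C K t I Lambda.
Implicit Types (x y : R) (v w : T).

Local Notation gamma x := (hproj (zeta x)).
Local Notation D := (diam hdist K).
Local Notation lo := (arc_left zeta I).
Local Notation hi := (arc_right zeta I).
Local Notation mid := (tile_mid lo hi).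
Local Notation G := (ordered_generation zeta t I).
Local Notation g := (gcurve zeta t I Lambda).

Let tl : tiling mu G lo hi (children_seq t) := patchwork_tiling zeta_incr patch.

Definition first_vertex i : T := head (tree_root t) (G i).
Definition last_vertex i : T := last (tree_root t) (G i).
Definition inner_nodes i : seq (R * plane R n) :=
  rcons [seq (mid w, Lambda w) | w <- G i] (1, Lambda (last_vertex i)).

Definition gprimitive i : R -> R :=
  pl_primitive 0 (Lambda (first_vertex i)) (inner_nodes i).

Lemma gcurveE i : g i = pl_interp 0 (Lambda (first_vertex i)) (inner_nodes i).
Proof. by []. Qed.

Lemma unzip1_inner_nodes i : unzip1 (inner_nodes i) = rcons [seq mid w | w <- G i] 1.
Proof. by rewrite /unzip1 map_rcons -map_comp. Qed.

Lemma sorted_generation i : sorted (fun v w => lo v <= lo w) (G i).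
Proof. by apply: sort_sorted => v w; exact: le_total. Qed.

Lemma path_inner_nodes i : path <%R 0 (unzip1 (inner_nodes i)).
Proof.
rewrite unzip1_inner_nodes; apply: (path_tile_mid tl (i := i)) => //.
- exact: tile_uniq tl i.
- exact: sorted_generation.
- move=> w wi; have [w0 _ _] := tile_lt tl wi.
  by have /andP[m _] := tile_mid_in tl wi; exact: le_lt_trans m.
Qed.

Lemma first_vertexP i : first_vertex i \in G i /\ lo (first_vertex i) = 0.
Proof.
have [|v vi /andP[v0 _]] := @tile_cover _ _ _ _ _ _ _ tl i 0.
  by rewrite lexx ler01.
have tr : transitive (fun v u => lo v <= lo u) by move=> x y z; exact: le_trans.
have := sorted_generation i; rewrite /first_vertex.
case: (G i) vi (tile_lt tl (i := i)) => //= w r vr lt_r ws.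
split; first exact: mem_head.
have [w0 _ _] := lt_r w (mem_head _ _); apply/le_anti; rewrite w0 andbT.
rewrite (le_trans _ v0)//; move: vr; rewrite inE => /predU1P[->//|vr].
by have /allP := order_path_min tr ws; apply.
Qed.

Lemma last_vertexP i : last_vertex i \in G i /\ hi (last_vertex i) = 1.
Proof.
have [|v vi /andP[_ v1]] := @tile_cover _ _ _ _ _ _ _ tl i 1.
  by rewrite lexx ler01.
have tr : transitive (fun v u => lo v <= lo u) by move=> x y z; exact: le_trans.
have wi : last_vertex i \in G i.
  by rewrite /last_vertex; case: (G i) vi => //= w r _; exact: mem_last.
split => //; have [_ ww w1] := tile_lt tl wi; have [v0 vv v1'] := tile_lt tl vi.
have vw : lo v <= lo (last_vertex i).
  move: vi (sorted_generation i); rewrite /last_vertex; case/lastP: (G i) => // r w.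
  rewrite mem_rcons last_rcons inE => /predU1P[->//|vr].
  by rewrite sorted_pairwise// pairwise_rcons => /andP[/allP/(_ v vr)].
have [<-|vneqw] := eqVneq v (last_vertex i).
  by apply/le_anti; rewrite v1 v1'.
by case: (tile_disjoint tl vi wi vneqw) => h; lra.
Qed.

Lemma node_vertex i c : c \in (0, Lambda (first_vertex i)) :: inner_nodes i ->
  exists2 w, w \in G i & c.2 = Lambda w /\ lo w <= c.1 <= hi w.
Proof.
have [fi f0] := first_vertexP i; have [li l1] := last_vertexP i.
have [_ ff _] := tile_lt tl fi; have [_ ll _] := tile_lt tl li.
rewrite inE mem_rcons inE => /or3P[/eqP->|/eqP->|/mapP[w wi ->]].
- by exists (first_vertex i) => //=; rewrite f0 lexx -f0 ltW.
- by exists (last_vertex i) => //=; rewrite l1 lexx -l1 ltW.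
- by exists w => //=; have /andP[/ltW-> /ltW->] := tile_mid_in tl wi.
Qed.

Lemma approx_mid i w : w \in G i ->
  edist (Lambda w) (gamma (mid w)) <= C * 2 ^- i * D.
Proof. by move=> /(mem_ordered_generation patch)/generationP <-; exact: approx. Qed.

(** If no midpoint of generation i lies in ]a, b[, then [[a, b]] is covered by
    two adjacent intervals of that generation. *)
Lemma gap_osc i w a b x y : w \in G i -> lo w <= a <= hi w -> b <= 1 ->
  {in G i, forall u, mid u <= a \/ b <= mid u} ->
  a <= x <= b -> a <= y <= b ->
  edist (gamma x) (gamma y) <= 2 * mu * 2 ^- i * D.
Proof.
move=> wi /andP[wa aw] b1 gap /andP[ax xb] /andP[ay yb].
set M := mu * 2 ^- i * D.
have -> : 2 * mu * 2 ^- i * D = M + M by rewrite /M; ring.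
have M0 : 0 <= M.
  by rewrite mulr_ge0 ?(ltW K_gt0)// mulr_ge0 ?(ltW mu0)// invr_ge0 exprn_ge0.
have osc v x' y' : v \in G i -> lo v <= x' <= hi v -> lo v <= y' <= hi v ->
    edist (gamma x') (gamma y') <= M.
  move=> vi xv yv; exact: (edist_patch_le K_gt0 zeta_incr patch vi xv yv).
have wx := le_trans wa ax; have wy := le_trans wa ay.
have [bw|wb] := leP b (hi w).
  by rewrite (le_trans (osc w _ _ wi _ _)) ?wx ?wy ?(le_trans xb)
    ?(le_trans yb)// lerDl.
have [u ui uw] := tile_next tl wi (lt_le_trans wb b1).
have /andP[um mu_] := tile_mid_in tl ui.
have bu : b <= hi u by have [|] := gap u ui; rewrite uw in um; lra.
have [_ ww _] := tile_lt tl wi; have [_ uu _] := tile_lt tl ui.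
have pivot z : a <= z -> z <= b -> edist (gamma z) (gamma (hi w)) <= M.
  move=> az zb; have [zw|wz] := leP z (hi w).
    by apply: (osc w) => //; rewrite ?(ltW ww) ?lexx// zw (le_trans wa).
  by apply: (osc u) => //; rewrite uw ?lexx ?(ltW wz) ?(le_trans zb)// -uw ltW.
rewrite (le_trans (edist_triangle (gamma (hi w)) _ _))// lerD ?pivot//.
by rewrite edistC pivot.
Qed.

Lemma edist_gcurve_le i x : 0 <= x <= 1 ->
  edist (g i x) (gamma x) <= (C + 3 * mu) * 2 ^- i * D.
Proof.
move=> /andP[x0 x1]; rewrite gcurveE.
have x_last : x <= last 0 (unzip1 (inner_nodes i)).
  by rewrite unzip1_inner_nodes last_rcons.
have [c [d [cl dl /andP[cx xd] nodes]]] :=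
  pl_interp_between (Lambda (first_vertex i)) (path_inner_nodes i) x0 x_last.
have [w wi [cE wc]] := node_vertex cl; have [u ui [dE ud]] := node_vertex dl.
have d1 : d.1 <= 1.
  by have [_ _ u1] := tile_lt tl ui; case/andP: ud => _ /le_trans; exact.
have gap : {in G i, forall v, mid v <= c.1 \/ d.1 <= mid v}.
  move=> v vi; apply/orP/nodes; rewrite inE unzip1_inner_nodes mem_rcons inE.
  by rewrite map_f ?orbT.
have near_node v z : v \in G i -> lo v <= z <= hi v -> c.1 <= z <= d.1 ->
    edist (Lambda v) (gamma x) <= (C + 3 * mu) * 2 ^- i * D.
  move=> vi vz cz; rewrite (le_trans (edist_triangle (gamma (mid v)) _ _))//.
  have vm : lo v <= mid v <= hi v by have /andP[/ltW-> /ltW->] := tile_mid_in tl vi.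
  have cxd : c.1 <= x <= d.1 by rewrite cx.
  have h1 := approx_mid vi.
  have h2 := edist_patch_le K_gt0 zeta_incr patch vi vm vz.
  have h3 := gap_osc wi wc d1 gap cz cxd.
  have h4 := edist_triangle (gamma z) (gamma (mid v)) (gamma x).
  lra.
by apply; [rewrite cE; apply: near_node wi wc _|rewrite dE; apply: near_node ui ud _];
  rewrite lexx ?andbT (le_trans cx).
Qed.

Local Notation kappa := (2 * C + 7 * mu).

Lemma delta_pairs i v p q : v \in G i ->
  (g i @` param_itv zeta (I v) `|` g i.+1 @` param_itv zeta (I v)) p ->
  (g i @` param_itv zeta (I v) `|` g i.+1 @` param_itv zeta (I v)) q ->
  edist p q <= kappa * D * 2 ^- i.
Proof.
move=> vi; have near_gamma p' :
    (g i @` param_itv zeta (I v) `|` g i.+1 @` param_itv zeta (I v)) p' ->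
    exists2 x, lo v <= x <= hi v &
      edist p' (gamma x) <= (C + 3 * mu) * 2 ^- i * D.
  have in_v x : param_itv zeta (I v) x -> lo v <= x <= hi v.
    by move=> [x01 Ivx]; apply/(mem_patch zeta_incr patch); split => //;
      move: x01; rewrite /= in_itv.
  move=> [|] [x /in_v xv <-]; exists x => //.
    exact/edist_gcurve_le/(mem_patch_unit zeta_incr patch xv).
  have x01 := mem_patch_unit zeta_incr patch xv.
  rewrite (le_trans (edist_gcurve_le _ x01))// ler_pM2r// ler_wpM2l//.
    by rewrite addr_ge0 ?mulr_ge0 ?(ltW C0) ?(ltW mu0).
  by rewrite lef_pV2 ?posrE ?exprn_gt0// ler_weXn2l// ler1n.
move=> /near_gamma[x xv px] /near_gamma[y yv qy].
have h1 := edist_triangle (gamma x) p q.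
have h2 := edist_triangle (gamma y) (gamma x) q.
have h3 := edist_patch_le K_gt0 zeta_incr patch vi xv yv.
rewrite edistC in qy; lra.
Qed.

Lemma gcurve_family : curve_family G lo hi (kappa * D) g gprimitive
  (delta zeta t I Lambda).
Proof.
have gen_eq i v : v \in G i -> gen t v = i.
  by move=> /(mem_ordered_generation patch)/generationP.
have mem_param v x : lo v <= x <= hi v -> param_itv zeta (I v) x.
  by move=> /(mem_patch zeta_incr patch)[x01 Iv]; split => //; rewrite /= in_itv.
have le_delta i v p q : v \in G i ->
    (g i @` param_itv zeta (I v) `|` g i.+1 @` param_itv zeta (I v)) p ->
    (g i @` param_itv zeta (I v) `|` g i.+1 @` param_itv zeta (I v)) q ->
    edist p q <= delta zeta t I Lambda v.
  move=> vi Ap Aq; rewrite /delta (gen_eq _ _ vi).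
  by apply: (le_diam _ Ap Aq) => p' q'; exact: delta_pairs vi.
split => [i x y x0 xy y1 nodes|i v x y vi xv yv|i v x y vi xv yv|i v vi].
- apply: (pl_primitive_chord _ (path_inner_nodes i) xy) => c.
  rewrite inE unzip1_inner_nodes mem_rcons inE => /or3P[/eqP->|/eqP->|/mapP[w wi ->]].
  + by rewrite ltNge x0.
  + by rewrite [_ < y]ltNge y1 andbF.
  + exact: nodes.
- by apply: (le_delta _ _ _ _ vi); left; [exists x|exists y] => //; exact: mem_param.
- apply: (le_delta _ _ _ _ vi).
    by right; exists x => //; exact: mem_param.
  by left; exists y => //; exact: mem_param.
- rewrite /delta (gen_eq _ _ vi); apply: diam_le => [|p q Ap Aq].
    exists (g i (lo v)); left; exists (lo v) => //; apply: mem_param.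
    by have [_ /ltW vv _] := tile_lt tl vi; rewrite lexx.
  exact: delta_pairs vi Ap Aq.
Qed.

Lemma is_symplectic_area_gcurve i :
  is_symplectic_area 0 1 (g i) (gprimitive i 1 - gprimitive i 0).
Proof. exact: is_symplectic_area_pl (path_inner_nodes i) ler01. Qed.

Lemma gcurve_continuous1 i e : 0 < e -> exists2 d, 0 < d &
  forall x, 0 <= x <= 1 -> 1 - x < d -> edist (g i x) (g i 1) <= e.
Proof.
move=> e0; have [M M0 hM] := pl_interp_lipschitz (Lambda (first_vertex i))
  (path_inner_nodes i).
have M1 : 0 < M + 1 by rewrite ltr_wpDl.
exists (e / (M + 1)) => [|x /andP[_ x1] xd]; first by rewrite divr_gt0.
rewrite (le_trans (hM _ _ x1))//.
have -> : e = (M + 1) * (e / (M + 1)) by rewrite mulrC divfK// gt_eqF.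
by apply: ler_pM => //; rewrite ?subr_ge0// ?lerDl// ltW.
Qed.

Lemma gamma_continuous1 e : 0 < e -> exists2 d, 0 < d &
  forall x, 0 <= x <= 1 -> 1 - x < d -> edist (gamma x) (gamma 1) <= e.
Proof.
move=> e0; have muD : 0 <= mu * D by rewrite mulr_ge0// ltW.
have [i hi_] := exists_exprV_le (isT : 1 < 2)%N muD e0.
have [li l1] := last_vertexP i; have [_ ll _] := tile_lt tl li.
exists (1 - lo (last_vertex i)) => [|x /andP[x0 x1] xd].
  by rewrite subr_gt0 -l1.
rewrite (le_trans (edist_patch_le K_gt0 zeta_incr patch li _ _))//.
- by rewrite l1 x1 andbT; lra.
- by rewrite l1 lexx andbT -l1 ltW.
by rewrite mulrAC.
Qed.

Lemma level_sigma_sum_le k : (sigma zeta t I Lambda < +oo)%E ->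
  \sum_(m < k) level_sigma G (delta zeta t I Lambda) m <=
  fine (sigma zeta t I Lambda).
Proof.
move=> sig_fin.
have sum_le (r : seq T) : uniq r ->
    \sum_(v <- r) delta zeta t I Lambda v ^+ 2 <= fine (sigma zeta t I Lambda).
  move=> ur; rewrite -lee_fin fineK; last first.
    by rewrite ge0_fin_numE// /sigma; apply: esum_ge0 => v _; rewrite lee_fin sqr_ge0.
  apply: esum_ge; exists [set` r]; first by split => //; exact: finite_seq.
  by rewrite -sumEFin fsbig_seq.
pose r := flatten [seq G m | m <- iota 0 k].
have -> : \sum_(m < k) level_sigma G (delta zeta t I Lambda) m =
    \sum_(v <- r) delta zeta t I Lambda v ^+ 2.
  by rewrite /level_sigma -(big_mkord xpredT (fun m => \sum_(v <- G m) _))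
    big_flatten big_map /index_iota subn0.
apply: sum_le; rewrite {}/r; elim: k => [//|k IH].
rewrite -[k.+1]addn1 iotaD map_cat flatten_cat add0n /= cats0 cat_uniq IH.
rewrite (tile_uniq tl) andbT /=; apply/hasPn => v /(mem_ordered_generation patch) vk.
apply/negP => /flattenP[_ /mapP[m +] ->]; rewrite mem_iota add0n => mk.
move=> /(mem_ordered_generation patch)/generationP vm.
by move/generationP: vk mk; rewrite vm => ->; rewrite ltnn.
Qed.

End Approximation.

(** * The area bound *)

(** With N the first integer such that D^2 4^-N <= sig, both terms of the bound
    are comparable to sig, up to a factor N, of order log (D^2 / sig). *)
Lemma le_sigma_log {R : realType} (x sig D a b : R) :
  0 <= sig -> 0 <= a -> 0 <= b ->
  (forall N : nat, `|x| <= (a + 8 * N%:R) * sig + b * D ^+ 2 * 4 ^- N) ->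
  `|x| <= (a + b + 19) * Num.max sig (sig * ln (D ^+ 2 / sig)).
Proof.
move=> sig0 a0 b0 xN; have bD : 0 <= b * D ^+ 2 by rewrite mulr_ge0// sqr_ge0.
have [sig_eq0|sig_neq0] := eqVneq sig 0.
  rewrite sig_eq0 mul0r maxxx mulr0 leNgt; apply/negP => x0.
  have x20 : 0 < `|x| / 2 by rewrite divr_gt0.
  have [N hN] := exists_exprV_le (isT : 1 < 4)%N bD x20.
  by have := xN N; rewrite sig_eq0 mulr0 add0r; lra.
have sigp : 0 < sig by rewrite lt_def sig_neq0.
set l := ln (D ^+ 2 / sig); set m := Num.max _ _.
have m1 : sig <= m by rewrite le_max lexx.
have m2 : sig * l <= m by rewrite le_max lexx orbT.
have ex_N : exists N, D ^+ 2 * 4 ^- N <= sig.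
  exact: (exists_exprV_le (isT : 1 < 4)%N (sqr_ge0 D) sigp).
case: (ex_minnP ex_N) => -[|N] hN minN; have := xN _.
  move=> /(_ 0%N); rewrite expr0 invr1 mulr1 mulr0 addr0.
  rewrite expr0 invr1 mulr1 in hN; have := ler_wpM2l b0 hN.
  by have := ler_wpM2l a0 m1; have := ler_wpM2l b0 m1; lra.
move=> /(_ N.+1).
have hN' : sig < D ^+ 2 * 4 ^- N.
  by rewrite ltNge; apply/negP => /minN; rewrite ltnn.
have N4 : 0 < 4 ^+ N :> R by rewrite exprn_gt0.
have lnN : N%:R * ln 4 < l.
  rewrite mulr_natl -lnXn// ltr_ln ?posrE//.
    by rewrite ltr_pdivlMr// mulrC -ltr_pdivlMr.
  rewrite divr_gt0// (lt_le_trans _ (_ : sig * 4 ^+ N <= _)) ?mulr_gt0//.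
  by rewrite ltW// -ltr_pdivlMr.
(* From exp (- ln 4) >= 1 - ln 4. *)
have ln4 : 3 / 4 <= ln 4 :> R.
  have := expR_ge1Dx (- ln 4 : R); rewrite expRN lnK ?posrE//; lra.
have NR : 0 <= N%:R :> R by [].
have Nl : N%:R * (3 / 4) <= l by rewrite (le_trans _ (ltW lnN))// ler_wpM2l.
have Nsig : sig * N%:R <= 4 / 3 * (sig * l).
  by have := ler_wpM2l sig0 Nl; lra.
have := ler_wpM2l b0 hN; rewrite mulrA => h1 h2.
have := ler_wpM2l a0 m1; have := ler_wpM2l b0 m1.
by rewrite -natr1 in h2; lra.
Qed.

Theorem proposition4p8 (R : realType) (n : nat) (mu C : R)
  (hn : (1 <= n)%N) (hmu : 1 < mu) (hC : 0 < C) :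
  exists2 c : R, 0 < c &
  forall (K : set (heisenberg R n)) (zeta : R -> heisenberg R n)
         (T : choiceType) (t : rooted_tree T) (I : T -> set (heisenberg R n))
         (Lambda : T -> plane R n),
    compact K -> connected K -> vertical_curve 2 K -> 0 < diam hdist K ->
    increasing_parameterization K zeta ->
    is_patchwork zeta mu K t I ->
    approximating_points zeta C K t I Lambda ->
    (sigma zeta t I Lambda < +oo)%E ->
    let hgamma := close_curve (fun x => hproj (zeta x)) in
    let g := gcurve zeta t I Lambda in
    let sig := fine (sigma zeta t I Lambda) in
    let area := symplectic_area 0 2 in
    [/\ has_symplectic_area 0 2 hgamma,
        forall i, has_symplectic_area 0 2 (close_curve (g i)),
        area (close_curve (g i)) @[i --> \oo] --> area hgamma,
        `|area hgamma|
          <= c * Num.max sig (sig * ln (diam hdist K ^+ 2 / sig))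
      & (forall i, g i 0 = g i 1) -> `|area hgamma| <= c * sig].
Proof.
have mu0 : 0 < mu by exact: lt_trans hmu.
pose kappa : R := 2 * C + 7 * mu.
have b0 : 0 <= 32 * kappa ^+ 2 by rewrite mulr_ge0// sqr_ge0.
have a0 : 0 <= 14 + mu by rewrite addr_ge0// ltW.
exists (14 + mu + 32 * kappa ^+ 2 + 19); first by rewrite ltr_wpDl// addr_ge0.
move=> K zeta T t I Lambda _ _ K_vertical K_gt0 zeta_incr patch approx sig_fin.
move=> hgamma g sig area.
pose D := diam hdist K; pose gamma x := hproj (zeta x).
pose A := gprimitive (zeta := zeta) (t := t) (I := I) (Lambda := Lambda).
have tl := patchwork_tiling zeta_incr patch.
have fam := gcurve_family mu0 hC K_gt0 zeta_incr patch approx.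
have level_le k := level_sigma_sum_le (Lambda := Lambda) zeta_incr patch k sig_fin.
have g_close i x : 0 <= x <= 1 ->
    edist (g i x) (gamma x) <= (C + 3 * mu) * D * 2 ^- i.
  move=> x01; rewrite mulrAC; exact: edist_gcurve_le x01.
have area_g i : is_symplectic_area 0 2 (close_curve (g i)) (excess g A i 0 1).
  rewrite /excess /chord (omegaC (g i 0)) mulrN opprK.
  apply: is_symplectic_area_close_curve.
    exact: (gcurve_continuous1 zeta_incr patch).
  exact: (is_symplectic_area_gcurve zeta_incr patch).
have limA := is_symplectic_area_limit tl fam level_le g_close
  (fun k w s u wk s0 sw wu u1 =>
     expr4_height_ge K_vertical K_gt0 zeta_incr patch wk s0 sw wu u1 mu0)
  (fun s u s0 su u1 => height_ge0 zeta_incr s0 (ltW su) u1)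
  (@partition_sum_height _ _ zeta)
  (fun s u => @exists_tile_inside _ _ _ _ _ _ _ _ K_gt0 zeta_incr patch s u).
have {limA} area_gamma := is_symplectic_area_close_curve
  (gamma_continuous1 mu0 K_gt0 zeta_incr patch) limA.
set L := lim _ + _ in area_gamma.
have cvgE : excess g A i 0 1 @[i --> \oo] --> L.
  rewrite /L (omegaC (gamma 1)) mulrN /excess.
  apply: cvgB; first exact: (cvgn_area tl fam level_le g_close).
  by apply: (@cvg_chord _ _ _ _ ((C + 3 * mu) * D)) => i; apply: g_close;
    rewrite ?lexx ?ler01.
have area_gE i : area (close_curve (g i)) = excess g A i 0 1.
  exact: symplectic_areaE (area_g i).
have area_gammaE : area hgamma = L by exact: symplectic_areaE area_gamma.
have norm_le (M : R) : (forall i, `|excess g A i 0 1| <= M) -> `|L| <= M.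
  move=> EM; apply: (cvgr_to_le (cvg_norm cvgE)).
  by near=> i; exact: EM.
have sig0 : 0 <= sig by have := level_le 0%N; rewrite big_ord0.
split.
- by exists L.
- by move=> i; exists (excess g A i 0 1).
- by rewrite area_gammaE; under eq_fun do rewrite area_gE.
- rewrite area_gammaE; apply: le_sigma_log => // N; apply: norm_le => i.
  rewrite (le_trans (norm_excess01_le tl fam level_le i N))//.
  by rewrite -/kappa exprMn mulrA.
- move=> g_closed; rewrite area_gammaE; apply: norm_le => i.
  rewrite (le_trans (norm_excess01_le_closed tl fam level_le i g_closed))//.
  by rewrite ler_wpM2r//; move: b0; lra.
Unshelve. all: by end_near. Qed.
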